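(* Let $H$ be an $\aleph_1$-free group. Then $H$ is n-slender, cm-slender, and lcH-slender. In particular, every abstract group homomorphism from a completely metrizable topological group to $H$ has open kernel, and every abstract group homomorphism from a locally compact Hausdorff topological group to $H$ has open kernel.
   Context: A group is $\aleph_1$-free if every countable subgroup (equivalently, every subgroup generated by fewer than $\aleph_1$ elements) is a free group. A group $H$ is cm-slender if every abstract homomorphism from a completely metrizable topological group to $H$ has open kernel; $H$ is lcH-slender if every abstract homomorphism from a locally compact Hausdorff topological group to $H$ has open kernel. The Hawaiian earring group $\mathcal{H}$: fix letters $\{a_n^{\pm1}\}_{n\in\omega}$. A word is a function $W:\overline{W}\to\{a_n^{\pm1}\}_{n\in\omega}$ whose domain $\overline{W}$ is a totally ordered set such that for each $m$ the preimage $W^{-1}(\{a_n^{\pm1}\}_{n=0}^m)$ is finite; words are identified up to order isomorphism of domains preserving letters. For $m\in\omega$, $p_m(W)$ is the restriction of $W$ to $\{i: W(i)\in\{a_n^{\pm1}\}_{n=0}^m\}$, a finite word. Two words $W,U$ are equivalent if for every $m$, $p_m(W)$ and $p_m(U)$ are equal in the free group $F(a_0,\dots,a_m)$. $\mathcal{H}$ is the set of equivalence classes with multiplication induced by concatenation (ordered disjoint union of domains, first word below second) and inverse induced by reversing the order and inverting letters. $p_m$ induces a retraction homomorphism $p_m:\mathcal{H}\to\mathcal{H}_m$ onto the subgroup $\mathcal{H}_m\cong F(a_0,\dots,a_m)$ of classes of finite words in $a_0,\dots,a_m$. $\mathcal{H}^m$ denotes the subgroup of elements having a representative word using no letter from $\{a_n^{\pm1}\}_{n=0}^m$.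 A group $H$ is n-slender if for every homomorphism $\phi:\mathcal{H}\to H$ there is $m\in\omega$ with $\phi=\phi\circ p_m$, equivalently $\mathcal{H}^m\le\ker\phi$. *)

(* Defs.v *)
From Stdlib Require Import Reals List Sorting.Sorted Arith.
Import ListNotations.
Open Scope R_scope.

Record Group := {
  gcar : Type;
  gmul : gcar -> gcar -> gcar;
  gone : gcar;
  ginv : gcar -> gcar;
  gmul_assoc : forall x y z, gmul x (gmul y z) = gmul (gmul x y) z;
  gmul_1l : forall x, gmul gone x = x;
  gmul_1r : forall x, gmul x gone = x;
  gmul_Vl : forall x, gmul (ginv x) x = gone;
  gmul_Vr : forall x, gmul x (ginv x) = gone
}.

Definition is_hom (G K : Group) (f : gcar G -> gcar K) : Prop :=
  forall x y, f (gmul G x y) = gmul K (f x) (f y).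

Definition is_subgroup (G : Group) (S : gcar G -> Prop) : Prop :=
  S (gone G) /\ (forall x y, S x -> S y -> S (gmul G x y)) /\
  (forall x, S x -> S (ginv G x)).

(* A subset is countable if it is covered by the range of a sequence
   (subgroups are nonempty, so this is the usual notion for them). *)
Definition countable_set (T : Type) (S : T -> Prop) : Prop :=
  exists f : nat -> T, forall x, S x -> exists n, f n = x.

Fixpoint eval_gword (G : Group) (w : list (gcar G * bool)) : gcar G :=
  match w with
  | [] => gone G
  | (b, true) :: t => gmul G b (eval_gword G t)
  | (b, false) :: t => gmul G (ginv G b) (eval_gword G t)
  end.

Fixpoint greduced (T : Type) (w : list (T * bool)) : Prop :=
  match w with
  | [] => True
  | (x, s) :: t =>
      match t with
      | [] => True
      | (y, s') :: _ => ~ (x = y /\ s' = negb s)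
      end /\ greduced T t
  end.

Definition free_basis (G : Group) (S B : gcar G -> Prop) : Prop :=
  (forall b, B b -> S b) /\
  (forall x, S x -> exists w : list (gcar G * bool),
       (forall p, In p w -> B (fst p)) /\ eval_gword G w = x) /\
  (forall w : list (gcar G * bool),
       (forall p, In p w -> B (fst p)) -> greduced (gcar G) w ->
       w <> [] -> eval_gword G w <> gone G).

Definition free_subgroup (G : Group) (S : gcar G -> Prop) : Prop :=
  is_subgroup G S /\ exists B, free_basis G S B.

Definition aleph1_free (G : Group) : Prop :=
  forall S, is_subgroup G S -> countable_set (gcar G) S -> free_subgroup G S.

Record TopGroup := {
  tgrp : Group;
  topen : (gcar tgrp -> Prop) -> Prop;
  topen_full : topen (fun _ => True);
  topen_inter : forall U V, topen U -> topen V -> topen (fun x => U x /\ V x);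
  topen_union : forall F : (gcar tgrp -> Prop) -> Prop,
      (forall U, F U -> topen U) -> topen (fun x => exists U, F U /\ U x);
  tmul_cont : forall U, topen U -> forall x y, U (gmul tgrp x y) ->
      exists V W, topen V /\ topen W /\ V x /\ W y /\
        (forall a b, V a -> W b -> U (gmul tgrp a b));
  tinv_cont : forall U, topen U -> topen (fun x => U (ginv tgrp x))
}.

Definition is_metric (T : Type) (d : T -> T -> R) : Prop :=
  (forall x y, 0 <= d x y) /\ (forall x y, d x y = 0 <-> x = y) /\
  (forall x y, d x y = d y x) /\ (forall x y z, d x z <= d x y + d y z).

Definition metric_complete (T : Type) (d : T -> T -> R) : Prop :=
  forall u : nat -> T,
    (forall eps, 0 < eps -> exists N, forall n m, (N <= n)%nat -> (N <= m)%nat ->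
        d (u n) (u m) < eps) ->
    exists l, forall eps, 0 < eps -> exists N, forall n, (N <= n)%nat -> d (u n) l < eps.

Definition completely_metrizable (G : TopGroup) : Prop :=
  exists d : gcar (tgrp G) -> gcar (tgrp G) -> R,
    is_metric _ d /\ metric_complete _ d /\
    forall U, topen G U <->
      (forall x, U x -> exists eps, 0 < eps /\ forall y, d x y < eps -> U y).

Definition compact_set (G : TopGroup) (K : gcar (tgrp G) -> Prop) : Prop :=
  forall C : (gcar (tgrp G) -> Prop) -> Prop,
    (forall U, C U -> topen G U) ->
    (forall x, K x -> exists U, C U /\ U x) ->
    exists l : list (gcar (tgrp G) -> Prop),
      (forall U, In U l -> C U) /\ (forall x, K x -> exists U, In U l /\ U x).

Definition hausdorff (G : TopGroup) : Prop :=
  forall x y : gcar (tgrp G), x <> y ->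
    exists U V, topen G U /\ topen G V /\ U x /\ V y /\ (forall z, ~ (U z /\ V z)).

Definition locally_compact (G : TopGroup) : Prop :=
  forall x : gcar (tgrp G), exists U K, topen G U /\ U x /\
    (forall y, U y -> K y) /\ compact_set G K.

Definition open_kernel (G : TopGroup) (H : Group) (f : gcar (tgrp G) -> gcar H) : Prop :=
  topen G (fun x => f x = gone H).

Definition cm_slender (H : Group) : Prop :=
  forall (G : TopGroup) (f : gcar (tgrp G) -> gcar H),
    completely_metrizable G -> is_hom (tgrp G) H f -> open_kernel G H f.

Definition lcH_slender (H : Group) : Prop :=
  forall (G : TopGroup) (f : gcar (tgrp G) -> gcar H),
    locally_compact G -> hausdorff G -> is_hom (tgrp G) H f -> open_kernel G H f.

(* The Hawaiian earring group.  Letter (n, true) is a_n, (n, false) is a_n^-1. *)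
Definition letter := (nat * bool)%type.

Record HWord := {
  hdom : Type;
  hlt : hdom -> hdom -> Prop;
  hlt_irrefl : forall i, ~ hlt i i;
  hlt_trans : forall i j k, hlt i j -> hlt j k -> hlt i k;
  hlt_total : forall i j, hlt i j \/ i = j \/ hlt j i;
  hlab : hdom -> letter;
  hfin : forall m : nat, exists l : list hdom,
      forall i, In i l <-> (fst (hlab i) <= m)%nat
}.

(* l enumerates W^{-1}({a_n^{+-1}}_{n<=m}) in increasing order;
   then map (hlab W) l is the finite word p_m(W). *)
Definition proj_enum (W : HWord) (m : nat) (l : list (hdom W)) : Prop :=
  (forall i, In i l <-> (fst (hlab W i) <= m)%nat) /\ StronglySorted (hlt W) l.

Definition letter_cancel (x y : letter) : bool :=
  Nat.eqb (fst x) (fst y) && Bool.eqb (snd y) (negb (snd x)).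

Definition free_reduce (w : list letter) : list letter :=
  fold_right (fun x acc => match acc with
                           | y :: t => if letter_cancel x y then t else x :: acc
                           | [] => [x]
                           end) [] w.

(* W ~ U iff p_m(W) = p_m(U) in F(a_0..a_m) for every m. *)
Definition hequiv (W U : HWord) : Prop :=
  forall m l1 l2, proj_enum W m l1 -> proj_enum U m l2 ->
    free_reduce (map (hlab W) l1) = free_reduce (map (hlab U) l2).

Definition sum_lt (A B : Type) (ltA : A -> A -> Prop) (ltB : B -> B -> Prop)
  (x y : A + B) : Prop :=
  match x, y with
  | inl a, inl a' => ltA a a'
  | inr b, inr b' => ltB b b'
  | inl _, inr _ => True
  | inr _, inl _ => False
  end.

Definition sum_lab (W U : HWord) (x : hdom W + hdom U) : letter :=
  match x with inl a => hlab W a | inr b => hlab U b end.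

Lemma sum_lt_irrefl (W U : HWord) :
  forall i, ~ sum_lt _ _ (hlt W) (hlt U) i i.
Proof. intros [a|b]; simpl; [apply hlt_irrefl | apply hlt_irrefl]. Qed.

Lemma sum_lt_trans (W U : HWord) : forall i j k,
  sum_lt _ _ (hlt W) (hlt U) i j -> sum_lt _ _ (hlt W) (hlt U) j k ->
  sum_lt _ _ (hlt W) (hlt U) i k.
Proof.
  intros [a|b] [a'|b'] [a''|b'']; simpl; try tauto; eapply hlt_trans.
Qed.

Lemma sum_lt_total (W U : HWord) : forall i j,
  sum_lt _ _ (hlt W) (hlt U) i j \/ i = j \/ sum_lt _ _ (hlt W) (hlt U) j i.
Proof.
  intros [a|b] [a'|b']; simpl; auto.
  - destruct (hlt_total W a a') as [H|[H|H]]; auto. subst; auto.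
  - destruct (hlt_total U b b') as [H|[H|H]]; auto. subst; auto.
Qed.

Lemma sum_fin (W U : HWord) : forall m : nat, exists l : list (hdom W + hdom U),
  forall i, In i l <-> (fst (sum_lab W U i) <= m)%nat.
Proof.
  intros m. destruct (hfin W m) as [l1 H1]. destruct (hfin U m) as [l2 H2].
  exists (map inl l1 ++ map inr l2). intros [a|b]; simpl;
  rewrite in_app_iff, !in_map_iff.
  - rewrite <- H1. split.
    + intros [[x [Hx Hi]]|[x [Hx Hi]]]; [injection Hx; intros; subst; auto | discriminate].
    + intros Hi; left; exists a; auto.
  - rewrite <- H2. split.
    + intros [[x [Hx Hi]]|[x [Hx Hi]]]; [discriminate | injection Hx; intros; subst; auto].
    + intros Hi; right; exists b; auto.
Qed.

Definition hconcat (W U : HWord) : HWord := {|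
  hdom := hdom W + hdom U;
  hlt := sum_lt _ _ (hlt W) (hlt U);
  hlt_irrefl := sum_lt_irrefl W U;
  hlt_trans := sum_lt_trans W U;
  hlt_total := sum_lt_total W U;
  hlab := sum_lab W U;
  hfin := sum_fin W U |}.

(* A homomorphism from the Hawaiian earring group H (the quotient of words by
   hequiv, with multiplication induced by concatenation) to K is given by a
   map on words constant on equivalence classes and multiplicative. *)
Definition hawaiian_hom (K : Group) (phi : HWord -> gcar K) : Prop :=
  (forall W U, hequiv W U -> phi W = phi U) /\
  (forall W U, phi (hconcat W U) = gmul K (phi W) (phi U)).

Definition in_Hm (m : nat) (W : HWord) : Prop :=
  exists U, hequiv W U /\ forall i, (m < fst (hlab U i))%nat.

Definition n_slender (K : Group) : Prop :=
  forall phi : HWord -> gcar K, hawaiian_hom K phi ->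
    exists m : nat, forall W, in_Hm m W -> phi W = gone K.

(* Main.v *)
(** Suppose the kernel of a homomorphism [f] into the aleph_1-free group [K] is not open
    (respectively contains no H^m).  Then one can choose ever smaller elements [g n] with
    [f (g n) = a n ^ 6], [a n <> 1], together with exponents [l n], such that the infinite
    system [y n = g n * y (n + 1) ^ l n] is solvable: by an infinitely nested word in the
    Hawaiian earring group, by a limit in a complete metric, by compactness in the locally
    compact case.  The exponent [l n] is only required to exceed the exponent of every root of
    [a n ^ 6] in [K], which does not depend on the solution.

    The subgroup generated by all [a n] and [f (y n)] is countable, hence free.  In a free
    group, if [a] and [y] do not commute, then every conjugate of [a ^ 6 * y ^ l] is longer
    than the cyclically reduced core of [y]; if they commute, they are powers of one element
    and the choice of [l] gives the same conclusion.  Hence the cyclically reduced lengths of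
    [f (y 0)], [f (y 1)], ... decrease strictly, which is absurd. *)

Require Import Defs.
From Stdlib Require Import Reals List Sorting.Sorted Arith Lia Lra Classical
  ClassicalEpsilon FunctionalExtensionality PropExtensionality.
From Stdlib Require Cantor.
Import ListNotations.
Local Open Scope nat_scope.

(** * Groups and words *)

Local Arguments gmul {_} _ _.
Local Arguments gone {_}.
Local Arguments ginv {_} _.

Local Notation "x ** y" := (gmul x y) (at level 40, left associativity).
Local Notation "x ^-1" := (ginv x) (at level 3, left associativity, format "x ^-1").

Section GroupFacts.
Variable K : Group.
Implicit Types x y z g : gcar K.

Lemma gmulKl x y : x^-1 ** (x ** y) = y.
Proof. now rewrite gmul_assoc, gmul_Vl, gmul_1l. Qed.

Lemma gmulKVl x y : x ** (x^-1 ** y) = y.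
Proof. now rewrite gmul_assoc, gmul_Vr, gmul_1l. Qed.

Lemma gmul_cancel_l x y z : x ** y = x ** z -> y = z.
Proof. intros H. rewrite <- (gmulKl x y), H. apply gmulKl. Qed.

Lemma gmul_cancel_r x y z : y ** x = z ** x -> y = z.
Proof.
  intros H. rewrite <- (gmul_1r _ y), <- (gmul_Vr _ x), gmul_assoc, H.
  now rewrite <- gmul_assoc, gmul_Vr, gmul_1r.
Qed.

Lemma ginv_unique x y : x ** y = gone -> y = x^-1.
Proof. intros H. apply (gmul_cancel_l x). now rewrite gmul_Vr. Qed.

Lemma ginv_one : (gone : gcar K)^-1 = gone.
Proof. symmetry. apply ginv_unique, gmul_1l. Qed.

Lemma ginv_inv x : x^-1^-1 = x.
Proof. symmetry. apply ginv_unique, gmul_Vl. Qed.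

Lemma ginv_mul x y : (x ** y)^-1 = y^-1 ** x^-1.
Proof.
  symmetry. apply ginv_unique.
  now rewrite <- gmul_assoc, gmulKVl, gmul_Vr.
Qed.

End GroupFacts.

Ltac gsimpl :=
  repeat (rewrite <- gmul_assoc || rewrite gmul_1l || rewrite gmul_1r
    || rewrite gmul_Vl || rewrite gmul_Vr || rewrite gmulKl
    || rewrite gmulKVl || rewrite ginv_mul || rewrite ginv_inv || rewrite ginv_one).

Fixpoint gpow {K : Group} (x : gcar K) (n : nat) : gcar K :=
  match n with 0 => gone | S n => x ** gpow x n end.

Definition commute {K : Group} (x y : gcar K) : Prop := x ** y = y ** x.

Section Powers.
Variable K : Group.
Implicit Types x y z g : gcar K.

Lemma gpow_one n : gpow (gone : gcar K) n = gone.
Proof. induction n; simpl; auto. now rewrite IHn, gmul_1l. Qed.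

Lemma gpow_add x m n : gpow x (m + n) = gpow x m ** gpow x n.
Proof.
  induction m; simpl; [now rewrite gmul_1l|].
  now rewrite IHm, gmul_assoc.
Qed.

Lemma gpow_mul x m n : gpow x (m * n) = gpow (gpow x m) n.
Proof.
  induction n; [now rewrite Nat.mul_0_r|].
  rewrite Nat.mul_succ_r, Nat.add_comm, gpow_add, IHn. reflexivity.
Qed.

Lemma commute_sym x y : commute x y -> commute y x.
Proof. unfold commute; congruence. Qed.

Lemma commute_inv x y : commute x y -> commute x (y^-1).
Proof.
  unfold commute; intros H. apply (gmul_cancel_l _ y), (gmul_cancel_r _ y).
  gsimpl. now rewrite H.
Qed.

Lemma gpow_succ_r x n : gpow x (S n) = gpow x n ** x.
Proof. replace (S n) with (n + 1) by lia. rewrite gpow_add; simpl. now gsimpl. Qed.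

Lemma gpow_inv x n : gpow (x^-1) n = (gpow x n)^-1.
Proof.
  induction n; [simpl; now gsimpl|].
  rewrite (gpow_succ_r x), ginv_mul, <- IHn. reflexivity.
Qed.

Lemma gpow_conj g x n : gpow (g ** x ** g^-1) n = g ** gpow x n ** g^-1.
Proof.
  induction n; simpl; [now gsimpl|].
  rewrite IHn. now gsimpl.
Qed.

Lemma gpow_sub x m n : n <= m -> gpow (x^-1) n ** gpow x m = gpow x (m - n).
Proof.
  intros H. replace m with (n + (m - n)) at 1 by lia.
  rewrite gpow_add, gpow_inv. now gsimpl.
Qed.

End Powers.

(** * Reduced words and cyclic reduction *)

Section Words.
Variable T : Type.
Implicit Types (w u v d : list (T * bool)) (l : T * bool).

Definition flip l : T * bool := (fst l, negb (snd l)).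
Definition winv w := rev (map flip w).
(** Index form of [greduced]: a condition on adjacent pairs, easy to transport through concatenation
    and reversal. *)
Definition red w := forall i l, nth_error w i = Some l -> nth_error w (S i) <> Some (flip l).
Fixpoint wpow d n := match n with 0 => [] | S n => d ++ wpow d n end.

Lemma flip_flip l : flip (flip l) = l.
Proof. destruct l as [x []]; reflexivity. Qed.

Lemma winv_winv w : winv (winv w) = w.
Proof.
  unfold winv. rewrite map_rev, rev_involutive, map_map.
  erewrite map_ext; [apply map_id|]. intros; apply flip_flip.
Qed.

Lemma winv_app u v : winv (u ++ v) = winv v ++ winv u.
Proof. unfold winv. now rewrite map_app, rev_app_distr. Qed.

Lemma length_winv w : length (winv w) = length w.
Proof. unfold winv. now rewrite length_rev, length_map. Qed.

Lemma In_winv l w : In l (winv w) -> In (flip l) w.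
Proof.
  unfold winv. rewrite <- in_rev, in_map_iff. intros [x [<- Hx]].
  now rewrite flip_flip.
Qed.

Lemma length_wpow d n : length (wpow d n) = n * length d.
Proof. induction n; simpl; auto. now rewrite length_app, IHn. Qed.

Lemma wpow_succ_r d n : wpow d (S n) = wpow d n ++ d.
Proof.
  induction n; simpl; [now rewrite app_nil_r|].
  simpl in IHn. now rewrite IHn at 1; rewrite app_assoc.
Qed.

Lemma greduced_red w : greduced T w <-> red w.
Proof.
  induction w as [|[x s] t IH]; simpl.
  - split; auto. intros _ [|i] l; discriminate.
  - rewrite IH. split.
    + intros [H1 H2] [|i] l Hl; simpl in Hl; [|exact (H2 i l Hl)].
      injection Hl as <-. destruct t as [|[y s'] t]; simpl; [discriminate|].
      unfold flip; simpl. intros E; injection E as -> ->. now apply H1.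
    + intros H. split.
      * destruct t as [|[y s'] t]; auto. intros [-> ->].
        now apply (H 0 (y, s)).
      * intros i l Hl. exact (H (S i) l Hl).
Qed.

Lemma red_app_l u v : red (u ++ v) -> red u.
Proof.
  intros H i l Hl E. apply (H i l); rewrite nth_error_app1; auto;
  apply nth_error_Some; congruence.
Qed.

Lemma red_app_r u v : red (u ++ v) -> red v.
Proof.
  intros H i l Hl E. apply (H (length u + i) l).
  - rewrite nth_error_app2 by lia. now replace (length u + i - length u) with i by lia.
  - rewrite nth_error_app2 by lia. now replace (S (length u + i) - length u) with (S i) by lia.
Qed.

(** A nonempty [v] separates [u] from [w], so each adjacent pair already lies in [u ++ v] or in
    [v ++ w]. *)
Lemma red_glue u v w : red (u ++ v) -> red (v ++ w) -> v <> [] -> red (u ++ v ++ w).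
Proof.
  intros H1 H2 Hv i l Hl E.
  assert (Lv : 1 <= length v) by (destruct v; simpl; [easy|lia]).
  destruct (le_lt_dec (length u) i) as [Hi|Hi].
  - rewrite nth_error_app2 in Hl, E by lia.
    apply (H2 (i - length u) l Hl).
    now replace (S (i - length u)) with (S i - length u) by lia.
  - rewrite app_assoc, nth_error_app1 in Hl, E by (rewrite length_app; lia).
    exact (H1 i l Hl E).
Qed.

Lemma red_winv w : red w -> red (winv w).
Proof.
  intros H i l Hl E. unfold winv in *.
  assert (L : S i < length w).
  { rewrite <- (length_map flip), <- length_rev. apply nth_error_Some; congruence. }
  rewrite nth_error_rev, length_map in Hl, E.
  rewrite (proj2 (Nat.ltb_lt i _)) in Hl by lia.
  rewrite (proj2 (Nat.ltb_lt (S i) _)) in E by lia.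
  rewrite nth_error_map in Hl, E.
  apply (H (length w - S (S i)) (l)).
  - destruct (nth_error w (length w - S (S i))) as [p|]; simpl in E; [|discriminate].
    assert (E' : flip p = flip l) by congruence.
    now rewrite <- (flip_flip l), <- E', flip_flip.
  - replace (S (length w - S (S i))) with (length w - S i) by lia.
    destruct (nth_error w (length w - S i)) as [p|]; simpl in Hl; [|discriminate].
    assert (E' : flip p = l) by congruence. now rewrite <- E', flip_flip.
Qed.

Lemma red_wpow_app d v n :
  d <> [] -> red (d ++ d) -> red (d ++ v) -> red (wpow d (S n) ++ v).
Proof.
  intros Hd H1 H2. induction n; simpl; [now rewrite app_nil_r|].
  rewrite <- !app_assoc. apply red_glue; auto. now rewrite app_assoc.
Qed.

Lemma red_cons l w : red w -> (forall t, w <> flip l :: t) -> red (l :: w).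
Proof.
  intros H1 H2 [|i] l' Hl; simpl in *.
  - injection Hl as <-. destruct w; simpl; [discriminate|].
    intros E; injection E as ->. now apply (H2 w).
  - now apply H1.
Qed.

(** Mutually inverse end letters are stripped into [u] until the ends no longer cancel. Reducedness
    of [d ++ d] expresses that the core [d] is cyclically reduced. *)
Lemma cyclic_decomposition w : red w -> w <> [] ->
  exists u d, w = u ++ d ++ winv u /\ d <> [] /\ red (d ++ d).
Proof.
  remember (length w) as n eqn:Hn. revert w Hn.
  induction n as [n IH] using lt_wf_ind; intros w Hn Hr Hw.
  destruct w as [|l w]; [easy|].
  destruct (exists_last (l := l :: w)) as [m [l' Hm]]; [easy|].
  destruct (classic (l' = flip l)) as [E|E].
  - destruct m as [|l0 m]; [injection Hm as -> _; destruct l' as [x []]; discriminate|].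
    injection Hm as <- ->. subst l'.
    assert (Hm : m <> []).
    { intros ->. now apply (Hr 0 l). }
    destruct (IH (length m)) with (w := m) as (u & d & Em & Hd & Hdd); auto.
    { subst n; simpl. rewrite length_app; simpl; lia. }
    { apply (red_app_r [l]) in Hr. now apply red_app_l in Hr. }
    exists (l :: u), d. split; [|auto]. rewrite Em at 1.
    unfold winv; simpl. now rewrite <- !app_assoc.
  - exists [], (l :: w). rewrite app_nil_r. split; [auto|split; [easy|]].
    rewrite Hm at 1. rewrite <- app_assoc.
    destruct m as [|l0 m].
    { injection Hm as -> ->. apply red_cons; auto. intros t Et; now injection Et. }
    apply red_glue; [|apply red_cons; auto|easy].
    + now rewrite <- Hm.
    + intros t Et. injection Et as Et _. apply E.
      rewrite Et. now rewrite flip_flip.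
Qed.

Lemma longest_common_prefix u v : exists r u' v', u = r ++ u' /\ v = r ++ v' /\
  (forall l s t, u' = l :: s -> v' = l :: t -> False).
Proof.
  revert v; induction u as [|l u IH]; intros v.
  - exists [], [], v; repeat split; auto; discriminate.
  - destruct v as [|l' v]; [exists [], (l :: u), []; repeat split; auto; discriminate|].
    destruct (classic (l = l')) as [<-|N].
    + destruct (IH v) as (r & u' & v' & -> & -> & H).
      exists (l :: r), u', v'; auto.
    + exists [], (l :: u), (l' :: v); repeat split; auto. congruence.
Qed.

Lemma red_winv_app u v : red u -> red v ->
  (forall l s t, u = l :: s -> v = l :: t -> False) -> red (winv u ++ v).
Proof.
  intros Hu Hv H. destruct u as [|l u]; auto.
  apply red_winv in Hu. unfold winv in *; simpl in *. rewrite <- app_assoc; simpl.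
  apply (red_glue (rev (map flip u)) [flip l] v); auto; [|easy].
  apply red_cons; auto. intros t ->. rewrite flip_flip in H. now apply (H l u t).
Qed.

End Words.

Arguments flip {T}. Arguments winv {T}. Arguments red {T}. Arguments wpow {T}.

(** * Free groups *)

Lemma app_eq_length_inv (T : Type) (u u' v v' : list T) :
  u ++ v = u' ++ v' -> length u = length u' -> u = u' /\ v = v'.
Proof.
  revert u'; induction u as [|x u IH]; intros [|x' u'] E L; try discriminate; auto.
  injection E as -> E. injection L as L. now destruct (IH u' E L) as [-> ->].
Qed.

(** * Evaluation of words and paths in the Cayley graph *)

Section Evaluation.
Variable K : Group.
Implicit Types (w u v d : list (gcar K * bool)) (x y z : gcar K).
Local Notation ev := (eval_gword K).

Lemma eval_app u v : ev (u ++ v) = ev u ** ev v.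
Proof.
  induction u as [|[x []] u IH]; simpl; [now gsimpl| |]; now rewrite IH, gmul_assoc.
Qed.

Lemma eval_winv w : ev (winv w) = (ev w)^-1.
Proof.
  induction w as [|[x s] w IH]; [simpl; now gsimpl|].
  change (winv ((x, s) :: w)) with (winv w ++ [flip (x, s)]).
  rewrite eval_app, IH. destruct s; simpl; now gsimpl.
Qed.

Lemma eval_wpow d n : ev (wpow d n) = gpow (ev d) n.
Proof. induction n; simpl; auto. now rewrite eval_app, IHn. Qed.

Lemma eval_conj_wpow u d n :
  ev (u ++ wpow d n ++ winv u) = gpow (ev (u ++ d ++ winv u)) n.
Proof.
  rewrite !eval_app, !eval_winv, eval_wpow.
  rewrite !gmul_assoc. now rewrite gpow_conj.
Qed.

(** The vertex reached after [i] letters on the path of the Cayley graph that starts at 1 and spells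
    [w]. *)
Definition pref i w := ev (firstn i w).

(* Inside the powers of [d], a shift by one period is left translation by the element. *)
Lemma pref_shift u d n i (q := u ++ wpow d n ++ winv u) :
  length u <= i -> i + length d + length u <= length q ->
  pref (i + length d) q = ev (u ++ d ++ winv u) ** pref i q.
Proof.
  unfold pref, q. rewrite !length_app, length_winv, length_wpow. intros H1 H2.
  destruct n as [|n].
  - assert (E : d = []) by (destruct d; simpl in *; [auto|lia]). subst d.
    replace (i + _) with i by (simpl; lia).
    simpl. now rewrite eval_app, eval_winv; gsimpl.
  - replace i with (length u + (i - length u)) by lia.
    set (j := i - length u). rewrite <- Nat.add_assoc.
    rewrite !firstn_app_2, (Nat.add_comm j).
    (* One copy of [d] is split off in front on the left side and at the end on the right side; the
       next [j] letters then come from the same word [wpow d n]. *)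
    change (wpow d (S n)) with (d ++ wpow d n) at 1.
    rewrite <- app_assoc, firstn_app_2, wpow_succ_r, <- app_assoc.
    rewrite !firstn_app. replace (j - length (wpow d n)) with 0
      by (rewrite length_wpow; unfold j; simpl in H2; nia).
    simpl. rewrite !app_nil_r, !eval_app, eval_winv. now gsimpl.
Qed.

(** The last [i] letters of [q] invert its first [i], so walking back from the end retraces the
    initial segment translated by the value of [q]. *)
Lemma pref_mirror u d n i (q := u ++ wpow d n ++ winv u) :
  i <= length u -> pref (length q - i) q = ev q ** pref i q.
Proof.
  unfold pref, q. intros H.
  rewrite <- (firstn_skipn i u).
  set (u1 := firstn i u). set (u2 := skipn i u).
  assert (L1 : length u1 = i) by (unfold u1; rewrite length_firstn; lia).
  rewrite winv_app, !app_assoc, firstn_app.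
  rewrite !length_app, !length_winv.
  replace (_ - i - _) with 0 by lia. rewrite app_nil_r.
  rewrite firstn_all2 by (rewrite !length_app, !length_winv; lia).
  rewrite <- !app_assoc, firstn_app, L1, Nat.sub_diag, app_nil_r.
  rewrite firstn_all2 by lia. rewrite !eval_app, !eval_winv. now gsimpl.
Qed.

End Evaluation.

Arguments pref {K}.

(** * Normal forms in a free group *)

Section FreeGroup.
Variable K : Group.
Variables F B : gcar K -> Prop.
Hypothesis HF : is_subgroup K F.
Hypothesis HB : free_basis K F B.
Implicit Types (w u v d : list (gcar K * bool)) (x y z g : gcar K).
Local Notation ev := (eval_gword K).

Definition over w := forall p, In p w -> B (fst p).
Definition nf x w := over w /\ red w /\ ev w = x.

Lemma over_app u v : over (u ++ v) <-> over u /\ over v.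
Proof.
  unfold over. split; [intros H; split; intros p Hp; apply H, in_app_iff; auto|].
  intros [H1 H2] p Hp. apply in_app_iff in Hp as []; auto.
Qed.

Lemma over_winv w : over w -> over (winv w).
Proof. intros H p Hp. exact (H _ (In_winv _ _ _ Hp)). Qed.

Lemma over_wpow d n : over d -> over (wpow d n).
Proof. intros H; induction n; simpl; [easy|]. now apply over_app. Qed.

Lemma subgroup_eval w : over w -> F (ev w).
Proof.
  destruct HF as (F1 & FM & FV). destruct HB as (BS & _ & _).
  induction w as [|[x s] w IH]; intros H; simpl; auto.
  assert (F x) by (apply BS; apply (H (x, s)); now left).
  assert (F (ev w)) by (apply IH; intros p Hp; apply H; now right).
  destruct s; auto.
Qed.

Lemma nf_subgroup x w : nf x w -> F x.
Proof. intros (H & _ & <-). now apply subgroup_eval. Qed.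

Lemma nf_exists x : F x -> exists w, nf x w.
Proof.
  destruct HB as (_ & Bgen & _). intros Hx. destruct (Bgen x Hx) as (w & Hw & <-).
  clear Hx. induction w as [|l w IH].
  - exists []; repeat split; auto. intros [|i] l; discriminate.
  - destruct IH as (r & Hr & Rr & Er); [intros p Hp; apply Hw; now right|].
    destruct (classic (exists t, r = flip l :: t)) as [[t ->]|N].
    + exists t. split; [intros p Hp; apply Hr; now right|].
      split; [now apply (red_app_r _ [flip l])|].
      destruct l as [x []]; simpl in Er |- *; rewrite <- Er; now gsimpl.
    + exists (l :: r). split; [|split].
      * intros p [<-|Hp]; [apply Hw; now left|auto].
      * apply red_cons; auto. intros t ->. apply N; eauto.
      * destruct l as [x []]; simpl; now rewrite Er.
Qed.

Lemma nf_one_nil w : nf gone w -> w = [].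
Proof.
  intros (H1 & H2 & H3). destruct HB as (_ & _ & Bfree).
  apply NNPP; intros N. now apply (Bfree w H1); [apply greduced_red| |].
Qed.

(** All cancellation in the quotient happens within the longest common prefix [r] of the two normal
    forms. *)
Lemma nf_lcp x y v w : nf x v -> nf y w -> exists r v' w',
  v = r ++ v' /\ w = r ++ w' /\ nf (x^-1 ** y) (winv v' ++ w').
Proof.
  intros (V1 & V2 & V3) (W1 & W2 & W3).
  destruct (longest_common_prefix _ v w) as (r & v' & w' & -> & -> & H).
  exists r, v', w'. split; [auto|split; [auto|]].
  apply over_app in V1 as [? ?], W1 as [? ?]. split; [|split].
  - apply over_app; split; auto. now apply over_winv.
  - apply red_winv_app; auto; eapply red_app_r; eauto.
  - rewrite <- V3, <- W3, !eval_app, eval_winv. now gsimpl.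
Qed.

Lemma nf_unique x v w : nf x v -> nf x w -> v = w.
Proof.
  intros Hv Hw. destruct (nf_lcp _ _ _ _ Hv Hw) as (r & v' & w' & -> & -> & H).
  rewrite gmul_Vl in H. apply nf_one_nil in H. apply app_eq_nil in H as [E ->].
  now rewrite <- (winv_winv _ v'), E.
Qed.

(** With [d] the cyclically reduced core of [x], taking powers only repeats [d], without
    cancellation. At [n = 0] the word [u ++ winv u] need not be reduced, hence [1 <= n]. *)
Lemma nf_powers x : F x -> x <> gone -> exists u d, d <> [] /\
  x = ev (u ++ d ++ winv u) /\ (forall n, 1 <= n ->
  nf (gpow x n) (u ++ wpow d n ++ winv u) /\ nf (gpow (ev d) n) (wpow d n)).
Proof.
  intros Hx N. destruct (nf_exists x Hx) as (w & H1 & H2 & H3).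
  assert (Nw : w <> []) by (intros ->; now apply N).
  destruct (cyclic_decomposition _ w H2 Nw) as (u & d & -> & Hd & Hdd).
  exists u, d. split; [auto|split; [auto|]]. intros [|n] Hn; [lia|].
  apply over_app in H1 as [Hu H1]. apply over_app in H1 as [Od Ou].
  assert (R : red (wpow d (S n) ++ winv u)).
  { apply red_wpow_app; auto. now apply red_app_r in H2. }
  split; split.
  - rewrite !over_app. auto using over_wpow.
  - split; [|now rewrite eval_conj_wpow, H3].
    simpl. rewrite <- app_assoc. apply red_glue; auto.
    + rewrite app_assoc in H2. now apply red_app_l in H2.
    + simpl in R. now rewrite <- app_assoc in R.
  - now apply over_wpow.
  - split; [now apply red_app_l in R|apply eval_wpow].
Qed.

(** The normal form of the power contains [m] copies of a nonempty core; this bounds the exponents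
    of roots. *)
Lemma length_power_ge x m w : F x -> x <> gone -> nf (gpow x m) w -> m <= length w.
Proof.
  intros Hx N H. destruct m as [|m]; [lia|].
  destruct (nf_powers x Hx N) as (u & d & Hd & _ & P).
  destruct (P (S m)) as [P1 _]; [lia|].
  rewrite (nf_unique _ _ _ H P1), !length_app, length_wpow.
  destruct d; simpl length; [easy|nia].
Qed.

Lemma torsion_free x m : F x -> gpow x m = gone -> m = 0 \/ x = gone.
Proof.
  intros Hx H. destruct (classic (x = gone)) as [|N]; auto. left.
  assert (m <= length (@nil (gcar K * bool))); [|simpl in *; lia].
  apply (length_power_ge x); auto. rewrite H. repeat split; [easy|].
  intros [|i] l; discriminate.
Qed.

(* Comparing the normal forms of the m-th and of the 2m-th powers matches the
   conjugators and the cores. *)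
Lemma unique_roots x y m : F x -> F y -> 1 <= m -> gpow x m = gpow y m -> x = y.
Proof.
  intros Hx Hy Hm E.
  destruct (classic (x = gone)) as [->|Nx].
  { rewrite gpow_one in E. symmetry in E. apply torsion_free in E as [|]; auto; lia. }
  destruct (classic (y = gone)) as [->|Ny].
  { rewrite gpow_one in E. apply torsion_free in E as [|]; auto; lia. }
  destruct (nf_powers x Hx Nx) as (u & d & Hd & Ex & P).
  destruct (nf_powers y Hy Ny) as (v & c & Hc & Ey & Q).
  assert (E1 : u ++ wpow d m ++ winv u = v ++ wpow c m ++ winv v).
  { apply (nf_unique (gpow x m)); [apply P; lia|]. rewrite E. apply Q; lia. }
  assert (E2 : u ++ wpow d (m * 2) ++ winv u = v ++ wpow c (m * 2) ++ winv v).
  { apply (nf_unique (gpow x (m * 2))); [apply P; lia|].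
    rewrite gpow_mul, E, <- gpow_mul. apply Q; lia. }
  pose proof (f_equal (@length _) E1) as L1. pose proof (f_equal (@length _) E2) as L2.
  rewrite !length_app, !length_wpow, !length_winv in L1, L2.
  assert (Lu : length u = length v) by nia.
  assert (Ld : length d = length c) by nia.
  destruct m as [|m]; [lia|]. simpl in E1. rewrite <- !app_assoc in E1.
  apply app_eq_length_inv in E1 as [-> E1]; auto.
  apply app_eq_length_inv in E1 as [-> _]; auto. congruence.
Qed.

(** The equation says that conjugation by [x] inverts [y]. Then [x ** y] and [x] have the same
    square, and square roots are unique. *)
Lemma no_inversion x y : F x -> F y -> x = y ** x ** y -> y = gone.
Proof.
  intros Hx Hy E. apply (gmul_cancel_l _ x). rewrite gmul_1r.
  apply (unique_roots _ _ 2); auto; [now apply HF|].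
  simpl. gsimpl. now rewrite (gmul_assoc _ y x y), <- E.
Qed.

(* Let P = a^-6 and Q = y^l, so that z = P^-1 Q. If z were no longer than the core of y,
   the normal forms of P and Q would share a long prefix.  Either the conjugators of
   a and y have about the same length, and then the shared prefix contains both periods
   and forces a and y to commute, or one of them sticks out into the periodic part of
   the other element, which is thereby inverted by conjugation.  The constants 6 and 20
   need only be large enough for these estimates. *)
Lemma short_product a y u d l z w :
  F a -> F y -> a <> gone -> y <> gone -> ~ commute a y -> 20 <= l ->
  d <> [] -> y = ev (u ++ d ++ winv u) -> nf (gpow y l) (u ++ wpow d l ++ winv u) ->
  z = gpow a 6 ** gpow y l -> nf z w -> length d < length w.
Proof.
  intros Fa Fy Na Ny NC Hl Hd Ey NQ Ez Nz.
  set (b := a^-1). assert (Fb : F b) by now apply HF.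
  assert (Nb : b <> gone).
  { intros E. apply Na. rewrite <- (ginv_inv _ a). fold b. rewrite E. apply ginv_one. }
  destruct (nf_powers b Fb Nb) as (v & c & Hc & Eb & NP).
  destruct (NP 6) as [NP6 _]; [lia|]. clear NP.
  set (p := v ++ wpow c 6 ++ winv v) in *.
  set (q := u ++ wpow d l ++ winv u) in *.
  destruct (nf_lcp _ _ _ _ NP6 NQ) as (r & p' & q' & Ep & Eq & Nz').
  assert (Lw : length w = length p' + length q').
  { assert (E : (gpow b 6)^-1 ** gpow y l = z).
    { rewrite Ez. f_equal. unfold b. rewrite gpow_inv. now gsimpl. }
    rewrite E in Nz'. rewrite (nf_unique _ _ _ Nz Nz'), length_app, length_winv. lia. }
  (* Along the common prefix [r] the two paths visit the same vertices. *)
  assert (Agree : forall i, i <= length r -> pref i p = pref i q).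
  { intros i Hi. unfold pref. rewrite Ep, Eq, !firstn_app.
    now replace (i - length r) with 0 by lia. }
  assert (Shq : forall i, length u <= i -> i + length d + length u <= length q ->
    pref (i + length d) q = y ** pref i q).
  { intros i H1 H2. rewrite Ey. now apply pref_shift. }
  assert (Shp : forall i, length v <= i -> i + length c + length v <= length p ->
    pref (i + length c) p = b ** pref i p).
  { intros i H1 H2. rewrite Eb. now apply pref_shift. }
  assert (Miq : forall i, i <= length u -> pref (length q - i) q = gpow y l ** pref i q).
  { intros i H1. unfold q. rewrite pref_mirror by auto. f_equal. apply NQ. }
  assert (Mip : forall i, i <= length v -> pref (length p - i) p = gpow b 6 ** pref i p).
  { intros i H1. unfold p. rewrite pref_mirror by auto. f_equal. apply NP6. }
  assert (Lp : length p = length r + length p') by (rewrite Ep; apply length_app).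
  assert (Lq : length q = length r + length q') by (rewrite Eq; apply length_app).
  assert (Lp2 : length p = 2 * length v + 6 * length c).
  { unfold p. rewrite !length_app, length_winv, length_wpow. lia. }
  assert (Lq2 : length q = 2 * length u + l * length d).
  { unfold q. rewrite !length_app, length_winv, length_wpow. lia. }
  assert (L20 : 20 * length d <= l * length d) by nia.
  assert (Pc : 1 <= length c) by (destruct c; simpl; [easy|lia]).
  assert (Pd : 1 <= length d) by (destruct d; simpl; [easy|lia]).
  remember (l * length d) as L eqn:HL; clear HL.
  apply Nat.nle_gt; intros Hle.
  (* The conjugator [v] reaches at least two periods into the periodic part of [q]. Shifts by [y] at
     mirror positions of [p] show that conjugation by [gpow b 6] inverts [y]. *)
  destruct (le_lt_dec (length u + 2 * length d) (length v)) as [C2|C2].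
  { set (i := length v - length d).
    assert (E1 : pref (i + length d) q = y ** pref i q) by (apply Shq; lia).
    assert (E2 : pref (length p - (i + length d) + length d) q
      = y ** pref (length p - (i + length d)) q) by (apply Shq; lia).
    replace (length p - (i + length d) + length d) with (length p - i) in E2 by lia.
    rewrite <- !Agree in E1, E2 by lia.
    rewrite !Mip, E1 in E2 by lia.
    apply Ny, (no_inversion (gpow b 6)); auto.
    - eapply nf_subgroup; eauto.
    - apply (gmul_cancel_r _ (pref i p)). rewrite E2. now gsimpl. }
  (* The same with the roles exchanged: conjugation by [gpow y l] inverts [b]. *)
  destruct (le_lt_dec (length v + length d + length c) (length u)) as [C3|C3].
  { set (i := length u - length c).
    assert (E1 : pref (i + length c) p = b ** pref i p) by (apply Shp; lia).
    assert (E2 : pref (length q - (i + length c) + length c) p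
      = b ** pref (length q - (i + length c)) p) by (apply Shp; lia).
    replace (length q - (i + length c) + length c) with (length q - i) in E2 by lia.
    rewrite !Agree in E1, E2 by lia.
    rewrite !Miq, E1 in E2 by lia.
    apply Nb, (no_inversion (gpow y l)); auto.
    - eapply nf_subgroup; eauto.
    - apply (gmul_cancel_r _ (pref i q)). rewrite E2. now gsimpl. }
  (* From [i] on, both paths are periodic and still agree for the sum of the two periods. Shifting
     by the periods in either order ends at the same vertex, so [b] and [y] commute. *)
  apply NC.
  set (i := Nat.max (length u) (length v)).
  assert (E1 : pref (i + length d) q = y ** pref i q) by (apply Shq; lia).
  assert (E2 : pref (i + length c) p = b ** pref i p) by (apply Shp; lia).
  assert (E3 : pref (i + length c + length d) q = y ** pref (i + length c) q)
    by (apply Shq; lia).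
  assert (E4 : pref (i + length d + length c) p = b ** pref (i + length d) p)
    by (apply Shp; lia).
  rewrite !Agree in E2, E4 by lia.
  replace (i + length d + length c) with (i + length c + length d) in E4 by lia.
  rewrite E3, E1, E2 in E4.
  rewrite <- (ginv_inv _ a). fold b. apply commute_sym, commute_inv.
  unfold commute. apply (gmul_cancel_r _ (pref i q)). gsimpl. now rewrite E4.
Qed.

End FreeGroup.

(** * Aleph_1-free groups *)

Section Generation.
Variable K : Group.

Definition generated (X : nat -> gcar K) (x : gcar K) : Prop :=
  exists w : list (nat * bool), eval_gword K (map (fun p => (X (fst p), snd p)) w) = x.

Lemma generated_subgroup X : is_subgroup K (generated X).
Proof.
  split; [|split].
  - now exists [].
  - intros x y [u <-] [v <-]. exists (u ++ v). now rewrite map_app, eval_app.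
  - intros x [w <-]. exists (winv w). rewrite <- eval_winv. f_equal.
    unfold winv. rewrite map_rev. f_equal. rewrite !map_map. now apply map_ext.
Qed.

Lemma generated_gen X n : generated X (X n).
Proof. exists [(n, true)]; simpl. apply gmul_1r. Qed.

(** The length [k] is kept outside the code [n], in place of an end marker; the low bit of each head
    is the sign. *)
Fixpoint decode_list (k n : nat) : list (nat * bool) :=
  match k with
  | 0 => []
  | S k => let (h, t) := Cantor.of_nat n in (Nat.div2 h, Nat.odd h) :: decode_list k t
  end.

Lemma decode_list_surjective w : exists n, decode_list (length w) n = w.
Proof.
  induction w as [|[i s] w [n IH]]; [now exists 0|].
  exists (Cantor.to_nat (2 * i + Nat.b2n s, n)). simpl length.
  unfold decode_list; fold decode_list. rewrite Cantor.cancel_of_to, IH.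
  f_equal. f_equal.
  - destruct s; simpl Nat.b2n; [rewrite Nat.add_1_r; apply Nat.div2_succ_double|].
    now rewrite Nat.add_0_r, Nat.div2_double.
  - rewrite Nat.add_comm, Nat.odd_add_mul_2. now destruct s.
Qed.

Lemma generated_countable X : countable_set (gcar K) (generated X).
Proof.
  exists (fun n => let (k, m) := Cantor.of_nat n in
    eval_gword K (map (fun p => (X (fst p), snd p)) (decode_list k m))).
  intros x [w <-]. destruct (decode_list_surjective w) as [n E].
  exists (Cantor.to_nat (length w, n)). now rewrite Cantor.cancel_of_to, E.
Qed.

End Generation.

(** * Roots, commuting elements and the descent *)

Section AlephOneFree.
Variable K : Group.
Hypothesis HK : aleph1_free K.
Implicit Types x y z g a b c : gcar K.

Lemma generated_free X : is_subgroup K (generated K X) /\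
  exists B, free_basis K (generated K X) B.
Proof. apply HK; [apply generated_subgroup|apply generated_countable]. Qed.

Lemma eval_singleton_basis c w : (forall p, In p w -> fst p = c) ->
  exists n, eval_gword K w = gpow c n \/ eval_gword K w = gpow (c^-1) n.
Proof.
  induction w as [|[x s] w IH]; intros H; [now exists 0; left|].
  assert (E : x = c) by (apply (H (x, s)); now left). subst x.
  destruct IH as [n [E|E]]; [intros p Hp; apply H; now right| |];
    destruct s; simpl; rewrite E.
  - exists (S n). now left.
  - destruct n; [exists 1; right; reflexivity|].
    exists n. left. simpl. apply gmulKl.
  - destruct n; [exists 1; left; reflexivity|].
    exists n. right. simpl. apply gmulKVl.
  - exists (S n). now right.
Qed.

(* The subgroup generated by [x] and [y] is free and abelian: two distinct basis elements
   would not commute. *)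
Lemma commuting_cyclic x y : commute x y -> exists c,
  (forall S, is_subgroup K S -> S x -> S y -> S c) /\
  forall t, t = x \/ t = y -> exists n, t = gpow c n \/ t = gpow (c^-1) n.
Proof.
  intros Hc. set (X := fun n : nat => match n with 0 => x | _ => y end).
  assert (Sub : forall S, is_subgroup K S -> S x -> S y -> forall t, generated K X t -> S t).
  { intros S (S1 & SM & SV) Sx Sy t [w <-].
    induction w as [|[[|i] []] w IH]; simpl; auto. }
  (* Commuting with a fixed element is preserved by the group operations, so commutation passes from
     the generators to the whole subgroup, one argument at a time. *)
  assert (Cen : forall s t, generated K X s -> generated K X t -> commute s t).
  { assert (C1 : forall g, commute x g -> commute y g ->
      forall t, generated K X t -> commute t g).
    { intros g Hx Hy. apply (Sub (fun t => commute t g)); auto.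
      split; [|split]; unfold commute.
      - now gsimpl.
      - intros s t E1 E2. now rewrite <- gmul_assoc, E2, !gmul_assoc, E1.
      - intros s E. now apply commute_sym, commute_inv, commute_sym. }
    intros s t Hs Ht. apply C1; auto; apply commute_sym, C1; auto;
      try reflexivity. now apply commute_sym. }
  destruct (generated_free X) as [HS [B HB]].
  pose proof HB as (BS & Bgen & Bfree).
  assert (Bone : forall b b', B b -> B b' -> b = b').
  { intros b b' Hb Hb'. apply NNPP; intros N.
    apply (Bfree [(b, true); (b', true); (b, false); (b', false)]).
    - intros p [<-|[<-|[<-|[<-|[]]]]]; auto.
    - simpl. intuition congruence.
    - discriminate.
    - simpl. rewrite gmul_1r, !gmul_assoc, (Cen b b'); auto. now gsimpl. }
  assert (HX : forall t, t = x \/ t = y -> generated K X t).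
  { intros t [->| ->]; [apply (generated_gen K X 0)|apply (generated_gen K X 1)]. }
  destruct (classic (exists b, B b)) as [[c Hb]|N].
  - exists c. split; [intros S ? ? ?; apply (Sub S); auto|].
    intros t Ht. destruct (Bgen t (HX t Ht)) as (w & Hw & <-).
    apply eval_singleton_basis. intros p Hp. apply Bone; auto.
  - exists gone. split; [intros S HS' _ _; apply HS'|].
    intros t Ht. destruct (Bgen t (HX t Ht)) as (w & Hw & <-).
    exists 0. left. destruct w as [|p w]; auto.
    exfalso. apply N. exists (fst p). apply Hw. now left.
Qed.

(** Otherwise roots of [a] with exponents beyond every bound generate a countable, hence free,
    subgroup containing [a], and the length of the normal form of [a] there bounds the exponents. *)
Lemma root_bound a : a <> gone -> exists e, forall m b, gpow b m = a -> m <= e.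
Proof.
  intros Na. apply NNPP; intros N.
  assert (R : forall e, exists b, exists m, gpow b m = a /\ e < m).
  { intros e. apply NNPP; intros N'. apply N. exists e. intros m b E.
    apply Nat.nlt_ge; intros L. apply N'. eauto. }
  apply choice in R as [X HX].
  destruct (generated_free X) as [HS [B HB]].
  assert (Sa : generated K X a).
  { destruct (HX 0) as (m & E & _). rewrite <- E. clear E.
    assert (G := generated_gen K X 0). destruct HS as (S1 & SM & _).
    induction m; simpl; auto. }
  destruct (nf_exists K _ B HB a Sa) as (w & Hw).
  destruct (HX (length w)) as (m & E & L).
  apply (Nat.lt_irrefl m). eapply Nat.le_lt_trans; [|exact L].
  apply (length_power_ge K _ B HB (X (length w))).
  - apply generated_gen.
  - intros E'. rewrite E', gpow_one in E. auto.
  - now rewrite E.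
Qed.

Lemma torsion_free_aleph1 a m : a <> gone -> 1 <= m -> gpow a m <> gone.
Proof.
  intros Na Hm E. destruct (generated_free (fun _ => a)) as [HS [B HB]].
  destruct (torsion_free K _ B HB a m) as [|]; auto; [|lia].
  apply (generated_gen K (fun _ => a) 0).
Qed.

(* The exponents [l] are chosen knowing only [a], before [y] exists. *)
Definition large_exponent a l : Prop :=
  20 <= l /\ forall m b, gpow b m = gpow a 6 -> m + 2 <= l.

Lemma large_exponent_exists a : a <> gone -> exists l, large_exponent a l.
Proof.
  intros Na. destruct (root_bound (gpow a 6)) as [e He].
  - apply torsion_free_aleph1; auto. lia.
  - exists (e + 20). split; [lia|]. intros m b E. apply He in E. lia.
Qed.

(** Both elements are powers of one [c], oriented so that [y] has exponent [j > 0]. The sixth power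
    of [a] has exponent [p] or [-p] with [p + 2 <= l], so the product has exponent at least
    [j * l - p > j]. *)
Lemma commuting_step a y l : a <> gone -> y <> gone -> large_exponent a l -> commute a y ->
  exists c j m, (forall S, is_subgroup K S -> S a -> S y -> S c) /\
    y = gpow c j /\ gpow a 6 ** gpow y l = gpow c m /\ 1 <= j /\ j < m.
Proof.
  intros Na Ny [Hl He] C.
  assert (D : exists c, (forall S, is_subgroup K S -> S a -> S y -> S c) /\
    (exists j, y = gpow c j) /\ exists p, gpow a 6 = gpow c p \/ gpow a 6 = gpow (c^-1) p).
  { destruct (commuting_cyclic a y C) as (c & Hc & H).
    assert (A6 : forall c' n, a = gpow c' n -> gpow a 6 = gpow c' (n * 6)).
    { intros c' n ->. now rewrite gpow_mul. }
    destruct (H a) as [n Hn]; auto. destruct (H y) as [j [Hj|Hj]]; auto.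
    - exists c. repeat split; eauto. destruct Hn as [Hn|Hn]; apply A6 in Hn; eauto.
    - exists (c^-1). split; [intros S HS ? ?; apply HS; now apply Hc|]. split; eauto.
      destruct Hn as [Hn|Hn]; apply A6 in Hn; [|eauto].
      exists (n * 6). right. now rewrite ginv_inv. }
  destruct D as (c & Hc & [j Hj] & p & Hp).
  exists c, j. assert (Pj : 1 <= j).
  { destruct j; [|lia]. now rewrite Hj in Ny. }
  (* Either [c] or its inverse is a root of [gpow a 6] with exponent [p]. *)
  assert (Pp : p + 2 <= l) by (destruct Hp as [E|E]; symmetry in E; eauto).
  assert (Nlj : p + 2 + j <= l * j + 2) by nia.
  assert (P1 : 1 <= p).
  { destruct p; [|lia]. exfalso. apply (torsion_free_aleph1 a 6); auto; [lia|].
    destruct Hp as [E|E]; exact E. }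
  destruct Hp as [Hp|Hp].
  - exists (p + j * l). repeat split; auto; [|nia].
    now rewrite gpow_add, gpow_mul, <- Hj, Hp.
  - exists (j * l - p). repeat split; auto.
    + rewrite Hp, Hj, <- gpow_mul. apply gpow_sub. nia.
    + nia.
Qed.

Theorem no_infinite_system (a y : nat -> gcar K) (l : nat -> nat) :
  (forall n, a n <> gone) -> (forall n, large_exponent (a n) (l n)) ->
  (forall n, y n = gpow (a n) 6 ** gpow (y (S n)) (l n)) -> False.
Proof.
  intros Na Hl Hy.
  (* If [y n] were 1, the inverse of [y (S n)] would be a root of [gpow (a n) 6] with exponent
     [l n], against [large_exponent]. *)
  assert (Ny : forall n, y n <> gone).
  { intros n E. rewrite Hy in E. apply ginv_unique in E. destruct (Hl n) as [H20 H].
    assert (l n + 2 <= l n); [|lia]. apply (H _ (y (S n))^-1).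
    now rewrite gpow_inv, E, ginv_inv. }
  (* Interleaving puts both sequences into one countably generated subgroup. *)
  set (X := fun n => if Nat.even n then a (Nat.div2 n) else y (Nat.div2 n)).
  destruct (generated_free X) as [HF [B HB]]. set (F := generated K X) in *.
  assert (Fa : forall n, F (a n)).
  { intros n. replace (a n) with (X (2 * n)); [apply generated_gen|].
    unfold X. now rewrite Nat.even_even, Nat.div2_double. }
  assert (Fy : forall n, F (y n)).
  { intros n. replace (y n) with (X (S (2 * n))); [apply generated_gen|].
    unfold X. now rewrite Nat.even_succ, Nat.odd_even, Nat.div2_succ_double. }
  pose proof HF as (F1 & FM & FV).
  (* The induction is on the length of an arbitrary conjugate of [y n] within [F]; the conjugator
     [g] changes from step to step. *)
  assert (Descent : forall k n g w, F g -> nf K B (g^-1 ** y n ** g) w -> length w = k -> False).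
  2:{ destruct (nf_exists K F B HB (y 0)) as [w Hw]; auto.
      apply (Descent (length w) 0 gone w); auto. now gsimpl. }
  intros k. induction k as [k IH] using lt_wf_ind. intros n g w Fg Hw <-.
  set (cj := fun t => g^-1 ** t ** g).
  assert (cjS : forall t, F t -> F (cj t)) by (unfold cj; auto).
  assert (cjP : forall t m, cj (gpow t m) = gpow (cj t) m).
  { intros t m. unfold cj. rewrite <- (ginv_inv _ g) at 2 4. now rewrite gpow_conj. }
  assert (cjM : forall s t, cj (s ** t) = cj s ** cj t).
  { intros s t. unfold cj. now gsimpl. }
  assert (cj1 : forall t, cj t = gone -> t = gone).
  { unfold cj. intros t E. apply (gmul_cancel_r _ g), (gmul_cancel_l _ g^-1).
    rewrite gmul_assoc, E. now gsimpl. }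
  (* Conjugating further by the value of [u] leaves only the core. *)
  assert (Core : forall t u d, F t -> nf K B (eval_gword K d) d ->
    eval_gword K (u ++ d ++ winv u) = cj t -> nf K B (cj t) (u ++ d ++ winv u) ->
    exists h, F h /\ h^-1 ** t ** h = eval_gword K d).
  { intros t u d Ft Hd E (O & _ & _). exists (g ** eval_gword K u). split.
    - apply FM; auto. apply (subgroup_eval K F B HF HB). now apply over_app in O.
    - unfold cj in E. rewrite !eval_app, eval_winv in E.
      transitivity ((eval_gword K u)^-1 ** (g^-1 ** t ** g) ** eval_gword K u);
        [now gsimpl|]. rewrite <- E. now gsimpl. }
  fold (cj (y n)) in Hw.
  destruct (classic (commute (a n) (y (S n)))) as [C|C].
  - destruct (commuting_step _ _ _ (Na n) (Ny (S n)) (Hl n) C)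
      as (c & j & m & Hc & Ey & Em & Hj & Hjm).
    rewrite <- Hy in Em.
    assert (Fc : F c) by now apply Hc.
    assert (Nc : c <> gone).
    { intros ->. apply (Ny (S n)). now rewrite Ey, gpow_one. }
    (* The current conjugate of [y n] contains [m] copies of the core of [c], whereas [y (S n)] can
       be conjugated to exactly [j < m] copies. *)
    destruct (nf_powers K F B HB (cj c)) as (u & d & Hd & Ec & P); auto.
    destruct (P m) as [Pm _]; [lia|]. destruct (P j) as [Pj Pj']; [lia|].
    rewrite Em, cjP in Hw. rewrite (nf_unique K F B HB _ _ _ Hw Pm) in *.
    destruct (Core (y (S n)) u (wpow d j)) as (h & Fh & Eh); auto.
    { now rewrite eval_wpow. }
    { rewrite eval_conj_wpow, <- Ec, Ey. now rewrite cjP. }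
    { now rewrite Ey, cjP. }
    eapply (IH (length (wpow d j))); [|exact Fh| |reflexivity].
    + rewrite !length_app, !length_wpow. destruct d; [easy|simpl length; nia].
    + rewrite Eh, eval_wpow. exact Pj'.
  (* Conjugation by [g] preserves the equation, so [short_product] compares the core of [y (S n)]
     with the current conjugate of [y n]. *)
  - destruct (nf_powers K F B HB (cj (y (S n)))) as (u & d & Hd & Ec & P); auto.
    { intros E. now apply (Ny (S n)), cj1. }
    destruct (P 1) as [P1 P1']; [lia|].
    change (wpow d 1) with (d ++ []) in P1, P1'. rewrite app_nil_r in P1, P1'.
    simpl gpow in P1, P1'. rewrite gmul_1r in P1, P1'.
    destruct (Core (y (S n)) u d) as (h & Fh & Eh); auto.
    eapply (IH (length d)); [|exact Fh| |reflexivity].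
    + destruct (Hl n) as [H20 _].
      eapply (short_product K F B HF HB (cj (a n)) (cj (y (S n))) u d (l n) (cj (y n)));
        auto.
      * intros E. now apply (Na n), cj1.
      * intros E. now apply (Ny (S n)), cj1.
      * intros E. apply C. unfold commute in *. rewrite <- !cjM in E. unfold cj in E.
        now apply gmul_cancel_r, gmul_cancel_l in E.
      * apply P. lia.
      * now rewrite Hy, cjM, !cjP.
    + rewrite Eh. exact P1'.
Qed.

End AlephOneFree.

(* Most recent choice first. *)
Fixpoint history {T : Type} (g : nat -> T) (l : nat -> nat) (n : nat) : list (T * nat) :=
  match n with 0 => [] | S n => (g n, l n) :: history g l n end.

Lemma length_history (T : Type) (g : nat -> T) l n : length (history g l n) = n.
Proof. induction n; simpl; auto. Qed.

(* [Adm h x] says that [x] is a legal next choice after [h]; the exponent [l n] is fixed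
   before [g (n + 1)] is chosen. *)
Lemma selection (K : Group) (HK : aleph1_free K) (T : Type) (f : T -> gcar K)
    (Adm : list (T * nat) -> T -> Prop) :
  (forall h, exists x a, Adm h x /\ a <> gone /\ f x = gpow a 6) ->
  (forall g l, (forall n, Adm (history g l n) (g n)) ->
    exists y, forall n, y n = f (g n) ** gpow (y (S n)) (l n)) ->
  False.
Proof.
  intros Hch Hsol.
  assert (R : forall h, exists p : T * nat, Adm h (fst p) /\
    exists a, a <> gone /\ f (fst p) = gpow a 6 /\ large_exponent K a (snd p)).
  { intros h. destruct (Hch h) as (x & a & H1 & H2 & H3).
    destruct (large_exponent_exists K HK a H2) as [l Hl].
    exists (x, l). split; auto. exists a; auto. }
  apply choice in R as [step Hstep].
  set (hs := fix hs n := match n with 0 => [] | S n => step (hs n) :: hs n end).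
  set (g := fun n => fst (step (hs n))). set (l := fun n => snd (step (hs n))).
  assert (Eh : forall n, history g l n = hs n).
  { induction n; simpl; auto. rewrite IHn. unfold g, l. now rewrite <- surjective_pairing. }
  destruct (Hsol g l) as [y Hy].
  { intros n. rewrite Eh. apply Hstep. }
  assert (R : forall n, exists a, a <> gone /\ f (g n) = gpow a 6 /\ large_exponent K a (l n)).
  { intros n. apply Hstep. }
  apply choice in R as [a Ha].
  apply (no_infinite_system K HK a y l).
  - apply Ha.
  - apply Ha.
  - intros n. destruct (Ha n) as (_ & E & _). now rewrite <- E.
Qed.

(** * The Hawaiian earring group *)

(** The heads are least elements of the same set, hence equal. Thus the finite word [p_m] is
    independent of the enumeration. *)
Lemma strongly_sorted_unique (A : Type) (lt : A -> A -> Prop)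
  (Hirr : forall x, ~ lt x x) (Htr : forall x y z, lt x y -> lt y z -> lt x z) s t :
  StronglySorted lt s -> StronglySorted lt t -> (forall x, In x s <-> In x t) -> s = t.
Proof.
  intros Hs. revert t; induction Hs as [|a s Hs IH Ha]; intros t Ht Hin.
  - destruct t as [|b t]; auto. destruct (proj2 (Hin b)); now left.
  - rewrite Forall_forall in Ha. destruct Ht as [|b t Ht Hb].
    { destruct (proj1 (Hin a)); now left. }
    rewrite Forall_forall in Hb.
    assert (E : a = b).
    { destruct (proj1 (Hin a)) as [|Iat]; [now left|auto|].
      destruct (proj2 (Hin b)) as [|Ibs]; [now left|auto|].
      destruct (Hirr a). eauto. }
    subst b. f_equal. apply IH; auto. intros x. split; intros Hx.
    + destruct (proj1 (Hin x)) as [<-|]; [now right| |auto].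
      now destruct (Hirr a); apply Ha.
    + destruct (proj2 (Hin x)) as [<-|]; [now right| |auto].
      now destruct (Hirr a); apply Hb.
Qed.

Lemma strongly_sorted_map (A B : Type) (ltA : A -> A -> Prop) (ltB : B -> B -> Prop)
  (f : A -> B) s : (forall x y, ltA x y -> ltB (f x) (f y)) ->
  StronglySorted ltA s -> StronglySorted ltB (map f s).
Proof.
  intros Hf Hs. induction Hs as [|a s Hs IH Ha]; simpl; constructor; auto.
  rewrite Forall_forall in *. intros y Hy. apply in_map_iff in Hy as (x & <- & Hx). auto.
Qed.

(** The image of the increasing enumeration of the letters of index at most [m] is again one, so the
    finite words agree even before free reduction. *)
Lemma hequiv_of_iso (W U : HWord) (f : hdom W -> hdom U) :
  (forall i j, hlt W i j -> hlt U (f i) (f j)) ->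
  (forall i, hlab U (f i) = hlab W i) -> (forall j, exists i, f i = j) -> hequiv W U.
Proof.
  intros Hlt Hlab Hsur m s t [Hs1 Hs2] [Ht1 Ht2].
  assert (E : map f s = t).
  { apply (strongly_sorted_unique _ (hlt U)); auto.
    - apply hlt_irrefl.
    - apply hlt_trans.
    - eapply strongly_sorted_map; eauto.
    - intros j. rewrite Ht1, in_map_iff. split.
      + intros (i & <- & Hi). rewrite Hlab. now apply Hs1.
      + intros Hj. destruct (Hsur j) as [i <-]. exists i. split; auto.
        apply Hs1. now rewrite <- Hlab. }
  rewrite <- E, map_map. f_equal. apply map_ext. intros i. symmetry. apply Hlab.
Qed.

Definition hempty : HWord.
Proof.
  refine {| hdom := Empty_set; hlt := fun _ _ => False; hlab := fun i => match i with end |};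
    try (intros []; fail).
  intros m. exists []. intros [].
Defined.

Fixpoint hpow (W : HWord) (n : nat) : HWord :=
  match n with 0 => hempty | S n => hconcat W (hpow W n) end.

Section HawaiianHom.
Variables (K : Group) (phi : HWord -> gcar K).
Hypothesis Hphi : hawaiian_hom K phi.

Lemma phi_hempty : phi hempty = gone.
Proof.
  destruct Hphi as [H1 H2]. apply (gmul_cancel_l _ (phi hempty)).
  rewrite gmul_1r, <- H2. apply H1.
  apply (hequiv_of_iso (hconcat hempty hempty) hempty
    (fun i => match i with inl x => x | inr x => x end)).
  - intros [[]|[]].
  - intros [[]|[]].
  - intros [].
Qed.

Lemma phi_hpow W n : phi (hpow W n) = gpow (phi W) n.
Proof.
  induction n; simpl; [apply phi_hempty|].
  rewrite <- IHn. apply Hphi.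
Qed.

End HawaiianHom.

(** Index set for the copies of [W] in [hpow W n]; [None] is the least element and stands for the
    first copy. *)
Fixpoint fin (n : nat) : Set := match n with 0 => Empty_set | S n => option (fin n) end.

Fixpoint fin_lt {n : nat} : fin n -> fin n -> Prop :=
  match n with
  | 0 => fun _ _ => False
  | S n => fun i j => match i, j with
                      | None, None => False
                      | None, Some _ => True
                      | Some _, None => False
                      | Some i, Some j => fin_lt i j
                      end
  end.

Lemma fin_lt_irrefl n (i : fin n) : ~ fin_lt i i.
Proof. induction n; [destruct i|]. destruct i; simpl; auto. Qed.

Lemma fin_lt_trans n (i j k : fin n) : fin_lt i j -> fin_lt j k -> fin_lt i k.
Proof.
  induction n; [destruct i|]. destruct i, j, k; simpl; try tauto. apply IHn.
Qed.

Lemma fin_lt_total n (i j : fin n) : fin_lt i j \/ i = j \/ fin_lt j i.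
Proof.
  induction n; [destruct i|]. destruct i as [i|], j as [j|]; simpl; auto.
  destruct (IHn i j) as [|[->|]]; auto.
Qed.

Lemma fin_enum n : exists s : list (fin n), forall i, In i s.
Proof.
  induction n as [|n [s Hs]]; [now exists []|].
  exists (None :: map Some s). intros [i|]; simpl; auto. right. now apply in_map.
Qed.

(** Identifies the domain of the power with the lexicographic product of [fin n] and the domain of
    [W]. *)
Fixpoint hpow_pos (W : HWord) (n : nat) : fin n -> hdom W -> hdom (hpow W n) :=
  match n with
  | 0 => fun i _ => match i with end
  | S n => fun i x => match i with None => inl x | Some i => inr (hpow_pos W n i x) end
  end.

Lemma hpow_pos_lt W n i j x y : fin_lt i j \/ i = j /\ hlt W x y ->
  hlt (hpow W n) (hpow_pos W n i x) (hpow_pos W n j y).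
Proof.
  induction n; [destruct i|]. destruct i as [i|], j as [j|]; simpl; try tauto;
    intros [H|[E H]]; try easy; apply IHn; auto. right. split; congruence.
Qed.

Lemma hpow_pos_lab W n i x : hlab (hpow W n) (hpow_pos W n i x) = hlab W x.
Proof. induction n; [destruct i|]. destruct i; simpl; auto. Qed.

Lemma hpow_pos_surjective W n p : exists i x, hpow_pos W n i x = p.
Proof.
  induction n; [destruct p|]. destruct p as [x|p]; [now exists None, x|].
  destruct (IHn p) as (i & x & <-). now exists (Some i), x.
Qed.

Lemma hpow_lab_gt W n m : (forall i, m < fst (hlab W i)) ->
  forall i, m < fst (hlab (hpow W n) i).
Proof.
  intros H i. destruct (hpow_pos_surjective W n i) as (j & x & <-).
  now rewrite hpow_pos_lab.
Qed.

(* The word with [W n = g n . (W (n + 1)) ^ (l n)], unfolded for ever: a position is a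
   position of some [g (n + k)] reached by choosing one of the copies at each stage. *)
Section NestedWord.
Variables (g : nat -> HWord) (l : nat -> nat).
Hypothesis Hg : forall n i, n < fst (hlab (g n) i).

Inductive npos (n : nat) : Type :=
| here (x : hdom (g n))
| there (i : fin (l n)) (p : npos (S n)).
Arguments here {n}. Arguments there {n}.

Fixpoint nlt {n : nat} (p q : npos n) : Prop :=
  match p, q with
  | here x, here y => hlt (g n) x y
  | here _, there _ _ => True
  | there _ _, here _ => False
  | there i p, there j q => fin_lt i j \/ i = j /\ nlt p q
  end.

Fixpoint nlab {n : nat} (p : npos n) : letter :=
  match p with here x => hlab (g n) x | there _ p => nlab p end.

Lemma nlt_irrefl n (p : npos n) : ~ nlt p p.
Proof.
  induction p; simpl; [apply hlt_irrefl|]. intros [H|[_ H]]; auto.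
  now apply fin_lt_irrefl in H.
Qed.

Lemma nlt_trans n (p q r : npos n) : nlt p q -> nlt q r -> nlt p r.
Proof.
  revert q r; induction p as [n x|n i p IH]; intros [y|j q] [z|k r]; simpl; try tauto.
  - apply hlt_trans.
  - intros [H1|[-> H1]] [H2|[-> H2]]; eauto using fin_lt_trans.
Qed.

Lemma nlt_total n (p q : npos n) : nlt p q \/ p = q \/ nlt q p.
Proof.
  revert q; induction p as [n x|n i p IH]; intros [y|j q]; simpl; auto.
  - destruct (hlt_total (g n) x y) as [|[->|]]; auto.
  - destruct (fin_lt_total _ i j) as [|[->|]]; auto.
    destruct (IH q) as [|[->|]]; auto.
Qed.

Lemma nlab_gt n (p : npos n) : n < fst (nlab p).
Proof. induction p; simpl; auto. lia. Qed.

(** Letters of stage [n] have index above [n], so only stages below [m] contribute, each through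
    finitely many copies. *)
Lemma nfin n m : exists s : list (npos n), forall p, In p s <-> fst (nlab p) <= m.
Proof.
  destruct (le_lt_dec m n) as [Hmn|Hmn].
  { exists []. intros p. pose proof (nlab_gt n p). simpl. split; [easy|lia]. }
  remember (m - n) as k eqn:Hk. revert n Hmn Hk; induction k as [|k IH]; intros n Hmn Hk.
  { lia. }
  assert (E : exists s : list (npos (S n)), forall p, In p s <-> fst (nlab p) <= m).
  { destruct (le_lt_dec m (S n)) as [H|H]; [|apply IH; lia].
    exists []. intros p. pose proof (nlab_gt _ p). simpl. split; [easy|lia]. }
  destruct E as [s Hs]. destruct (hfin (g n) m) as [t Ht]. destruct (fin_enum (l n)) as [c Hc].
  exists (map here t ++ flat_map (fun i => map (there i) s) c).
  intros p. rewrite in_app_iff, in_map_iff, in_flat_map. split.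
  - intros [(x & <- & Hx)|(i & _ & Hp)]; [now apply Ht|].
    apply in_map_iff in Hp as (q & <- & Hq). now apply Hs.
  - destruct p as [x|i p]; simpl; intros H.
    + left. exists x. split; auto. now apply Ht.
    + right. exists i. split; auto. apply in_map. now apply Hs.
Qed.

Definition nested_word (n : nat) : HWord := {|
  hdom := npos n; hlt := nlt; hlt_irrefl := nlt_irrefl n; hlt_trans := nlt_trans n;
  hlt_total := nlt_total n; hlab := nlab; hfin := nfin n |}.

Lemma nested_word_unfold n :
  hequiv (nested_word n) (hconcat (g n) (hpow (nested_word (S n)) (l n))).
Proof.
  apply (hequiv_of_iso (nested_word n) (hconcat (g n) (hpow (nested_word (S n)) (l n)))
    (fun p : npos n => match p with
      | here x => inl x
      | there i q => inr (hpow_pos (nested_word (S n)) (l n) i q)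
      end)).
  - intros [x|i p] [y|j q]; simpl; auto. intros H. now apply hpow_pos_lt.
  - intros [x|i p]; simpl; auto. apply (hpow_pos_lab (nested_word (S n))).
  - intros [x|p]; [now exists (here x)|].
    destruct (hpow_pos_surjective _ _ p) as (i & q & <-). now exists (there i q).
Qed.

End NestedWord.

Theorem aleph1_free_n_slender (K : Group) : aleph1_free K -> n_slender K.
Proof.
  intros HK phi Hphi. apply NNPP; intros N.
  assert (Hch : forall m, exists W, (forall i, m < fst (hlab W i)) /\ phi W <> gone).
  { intros m. apply NNPP; intros N'. apply N. exists m. intros W (U & E & HU).
    apply NNPP; intros NW. apply N'. exists U. split; auto.
    rewrite <- (proj1 Hphi W U E). exact NW. }
  (* The choice at stage [n] uses only letters of index above [n], which keeps the nested word
     finite below every index. *)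
  apply (selection K HK HWord phi (fun h W => forall i, length h < fst (hlab W i))).
  - intros h. destruct (Hch (length h)) as (W & HW & NW).
    exists (hpow W 6), (phi W). split; [|split; auto].
    + now apply hpow_lab_gt.
    + now apply phi_hpow.
  - intros g l Hg.
    assert (Hg' : forall n i, n < fst (hlab (g n) i)).
    { intros n i. specialize (Hg n i). now rewrite length_history in Hg. }
    exists (fun n => phi (nested_word g l Hg' n)). intros n.
    rewrite (proj1 Hphi _ _ (nested_word_unfold g l Hg' n)), (proj2 Hphi).
    f_equal. now apply phi_hpow.
Qed.

(** * Topological groups *)

Section Topology.
Variable G : TopGroup.
Local Notation car := (gcar (tgrp G)).
Implicit Types (U V W C : car -> Prop) (x y g : car).

Lemma topen_ext U V : topen G U -> (forall x, U x <-> V x) -> topen G V.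
Proof.
  intros HU E. replace V with U; auto.
  apply functional_extensionality; intros x. now apply propositional_extensionality.
Qed.

Definition nbhd x U := exists V, topen G V /\ V x /\ forall y, V y -> U y.

Lemma topen_nbhd U : (forall x, U x -> nbhd x U) -> topen G U.
Proof.
  intros H. apply (topen_ext (fun x => exists V, (topen G V /\ (forall y, V y -> U y)) /\ V x)).
  - apply (topen_union G (fun V => topen G V /\ forall y, V y -> U y)). now intros V [].
  - intros x. split; [intros (V & [_ HV] & Vx); auto|].
    intros Ux. destruct (H x Ux) as (V & ? & ? & ?). exists V; auto.
Qed.

Lemma nbhd_and x U V : nbhd x U -> nbhd x V -> nbhd x (fun y => U y /\ V y).
Proof.
  intros (U' & OU & Ux & HU) (V' & OV & Vx & HV).
  exists (fun y => U' y /\ V' y). split; [now apply topen_inter|].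
  split; auto. intros y []; auto.
Qed.

Lemma nbhd_self x U : nbhd x U -> U x.
Proof. intros (V & _ & Vx & H). auto. Qed.

Lemma nbhd_mono x U V : nbhd x U -> (forall y, U y -> V y) -> nbhd x V.
Proof. intros (W & OW & Wx & H) HV. exists W; auto. Qed.

Lemma nbhd_open x U : topen G U -> U x -> nbhd x U.
Proof. intros; exists U; auto. Qed.

Definition continuous (f : car -> car) :=
  forall x U, nbhd (f x) U -> nbhd x (fun y => U (f y)).

Lemma continuous_preimage f U : continuous f -> topen G U -> topen G (fun x => U (f x)).
Proof. intros Hf OU. apply topen_nbhd. intros x Ux. now apply Hf, nbhd_open. Qed.

Lemma continuous_comp f h : continuous f -> continuous h -> continuous (fun x => f (h x)).
Proof. intros Hf Hh x U HU. apply (Hh x (fun y => U (f y))). now apply Hf. Qed.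

Lemma continuous_mul f h :
  continuous f -> continuous h -> continuous (fun x => f x ** h x).
Proof.
  intros Hf Hh x U (U' & OU & Ux & HU).
  destruct (tmul_cont G U' OU _ _ Ux) as (V & W & OV & OW & Vx & Wx & H).
  apply (nbhd_mono _ (fun y => V (f y) /\ W (h y))).
  - apply nbhd_and; [apply Hf|apply Hh]; now apply nbhd_open.
  - intros y []; auto.
Qed.

Lemma continuous_id : continuous (fun x => x).
Proof. intros x U HU. exact HU. Qed.

Lemma continuous_const g : continuous (fun _ => g).
Proof.
  intros x U HU. exists (fun _ => True). split; [apply topen_full|].
  split; auto. intros y _. now apply nbhd_self in HU.
Qed.

Lemma continuous_gpow n : continuous (fun x => gpow x n).
Proof.
  induction n; simpl; [apply continuous_const|].
  now apply continuous_mul; [apply continuous_id|].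
Qed.

(** Solves one equation of the system backwards: it gives [y n] from [y (S n)]. *)
Definition affine g (n : nat) x := g ** gpow x n.

Lemma continuous_affine g n : continuous (affine g n).
Proof. apply continuous_mul; [apply continuous_const|apply continuous_gpow]. Qed.

Lemma affine_one g n : affine g n gone = g.
Proof. unfold affine. now rewrite gpow_one, gmul_1r. Qed.

Section Kernel.
Variables (K : Group) (f : car -> gcar K).
Hypothesis Hf : is_hom (tgrp G) K f.

Lemma hom_one : f gone = gone.
Proof.
  apply (gmul_cancel_l _ (f gone)). rewrite <- (Hf gone gone). now rewrite !gmul_1r.
Qed.

Lemma hom_gpow x n : f (gpow x n) = gpow (f x) n.
Proof. induction n; simpl; [apply hom_one|]. now rewrite Hf, IHn. Qed.

Lemma open_kernel_of_nbhd : nbhd gone (fun x => f x = gone) -> open_kernel G K f.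
Proof.
  intros H. apply topen_nbhd. intros x Hx.
  assert (Hc : continuous (fun y => x^-1 ** y)).
  { apply continuous_mul; [apply continuous_const|apply continuous_id]. }
  assert (H' : nbhd x (fun y => f (x^-1 ** y) = gone)).
  { apply (Hc x (fun z => f z = gone)). now rewrite gmul_Vl. }
  apply (nbhd_mono _ _ _ H'). intros y Hy.
  rewrite <- (gmulKVl _ x y), Hf, Hx, Hy. apply gmul_1l.
Qed.

(** Some [x] outside the kernel is so near 1 that its sixth power lies in [U]; that power is the
    witness, with [a = f x]. *)
Lemma small_sixth_power U : ~ open_kernel G K f -> nbhd gone U ->
  exists x a, U x /\ a <> gone /\ f x = gpow a 6.
Proof.
  intros N HU. apply NNPP; intros N'. apply N, open_kernel_of_nbhd.
  assert (H : nbhd gone (fun x => U (gpow x 6))).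
  { apply continuous_gpow. now rewrite gpow_one. }
  apply (nbhd_mono _ _ _ H). intros x Hx. apply NNPP; intros Nx.
  apply N'. exists (gpow x 6), (f x). split; auto. split; auto. apply hom_gpow.
Qed.

End Kernel.

(** The most recent map is applied first, so a history of length [n] sends a value of the unknown
    [n] to one of the unknown 0, and its prefix of length [k] to one of the unknown [n - k]. *)
Definition compose_history (h : list (car * nat)) (x : car) : car :=
  fold_left (fun x p => affine (fst p) (snd p) x) h x.

Lemma continuous_compose_history h : continuous (compose_history h).
Proof.
  induction h as [|[g n] h IH]; [apply continuous_id|].
  apply (continuous_comp (compose_history h) (affine g n)); auto. apply continuous_affine.
Qed.

Lemma compose_history_app h h' x :
  compose_history (h ++ h') x = compose_history h' (compose_history h x).
Proof. apply fold_left_app. Qed.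

End Topology.

Arguments nbhd {G}. Arguments continuous {G}. Arguments affine {G}.
Arguments compose_history {G}.

Lemma nbhd_forall_le (G : TopGroup) (x : gcar (tgrp G)) (U : nat -> gcar (tgrp G) -> Prop) n :
  (forall k, k <= n -> nbhd x (U k)) -> nbhd x (fun y => forall k, k <= n -> U k y).
Proof.
  induction n as [|n IH]; intros H.
  - apply (nbhd_mono _ _ (U 0)); [auto|]. intros y Hy k Hk. now replace k with 0 by lia.
  - apply (nbhd_mono _ _ (fun y => (forall k, k <= n -> U k y) /\ U (S n) y)).
    + apply nbhd_and; auto.
    + intros y [H1 H2] k Hk. destruct (Nat.eq_dec k (S n)) as [->|]; auto. apply H1; lia.
Qed.

(** * Completely metrizable groups *)

Section CompletelyMetrizable.
Variable G : TopGroup.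
Local Notation car := (gcar (tgrp G)).
Variable d : car -> car -> R.
Hypothesis Hd : is_metric _ d.
Hypothesis Hcomplete : metric_complete _ d.
Hypothesis Htop : forall U, topen G U <->
  (forall x, U x -> exists eps, (0 < eps)%R /\ forall y, (d x y < eps)%R -> U y).

Definition converges (u : nat -> car) (y : car) :=
  forall eps, (0 < eps)%R -> exists N, forall n, N <= n -> (d (u n) y < eps)%R.

Lemma nbhd_ball x eps : (0 < eps)%R -> nbhd x (fun y => (d x y < eps)%R).
Proof.
  intros He. destruct Hd as (_ & D0 & _ & Dt). apply nbhd_open.
  - apply Htop. intros y Hy. exists (eps - d x y)%R. split; [lra|].
    intros z Hz. specialize (Dt x y z). lra.
  - now rewrite (proj2 (D0 x x)).
Qed.

Lemma converges_continuous f u y : continuous f -> converges u y ->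
  converges (fun n => f (u n)) (f y).
Proof.
  intros Hf Hu eps He. pose proof Hd as (_ & _ & Ds & _).
  destruct (Hf y _ (nbhd_ball (f y) eps He)) as (V & OV & Vy & HV).
  destruct (proj1 (Htop V) OV y Vy) as (e' & He' & H).
  destruct (Hu e' He') as [N HN]. exists N. intros n Hn.
  rewrite Ds. apply HV, H. rewrite Ds. auto.
Qed.

Lemma converges_unique u y z : converges u y -> converges u z -> y = z.
Proof.
  intros Hy Hz. destruct Hd as (D & D0 & Ds & Dt). apply D0.
  apply Rle_antisym; [|apply D]. apply Rnot_lt_le; intros L.
  destruct (Hy (d y z / 2)%R) as [N HN]; [lra|].
  destruct (Hz (d y z / 2)%R) as [N' HN']; [lra|].
  specialize (HN (N + N') ltac:(lia)). specialize (HN' (N + N') ltac:(lia)).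
  specialize (Dt y (u (N + N')) z). rewrite (Ds y (u (N + N'))) in Dt. lra.
Qed.

Lemma geometric_converges (u : nat -> car) n0 :
  (forall n, n0 <= n -> (d (u n) (u (S n)) < (/ 2) ^ n)%R) -> exists y, converges u y.
Proof.
  intros H. destruct Hd as (D & D0 & Ds & Dt). apply Hcomplete. intros eps He.
  (* The bound telescopes, because [(/ 2) ^ n] is the difference of [2 * (/ 2) ^ n] and
     [2 * (/ 2) ^ S n]. *)
  assert (Tail : forall k n, n0 <= n -> (d (u n) (u (n + k)%nat) <= 2 * (/ 2) ^ n - 2 * (/ 2) ^ (n + k))%R).
  { induction k as [|k IH]; intros n Hn.
    - rewrite Nat.add_0_r, (proj2 (D0 (u n) (u n))); [lra|auto].
    - specialize (IH n Hn). specialize (H (n + k) ltac:(lia)).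
      specialize (Dt (u n) (u (n + k)%nat) (u (n + S k)%nat)).
      rewrite Nat.add_succ_r in *. simpl pow. lra. }
  destruct (pow_lt_1_zero (/ 2)%R) with (y := (eps / 4)%R) as [N HN];
    [rewrite Rabs_pos_eq; lra|lra|].
  assert (Tail2 : forall n m, N + n0 <= n -> n <= m -> (d (u n) (u m) < eps)%R).
  { intros n m Hn Hm. specialize (Tail (m - n) n ltac:(lia)).
    replace (n + (m - n)) with m in Tail by lia.
    specialize (HN n ltac:(lia)).
    assert (0 < (/ 2) ^ n)%R by (apply pow_lt; lra).
    assert (0 < (/ 2) ^ m)%R by (apply pow_lt; lra).
    rewrite Rabs_pos_eq in HN by lra. lra. }
  exists (N + n0). intros n m Hn Hm. destruct (le_lt_dec n m); [now apply Tail2|].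
  rewrite Ds. apply Tail2; lia.
Qed.

(** The prefix of length [n - i] lists the stages [n - 1] down to [i]; its last entry is the
    outermost map. *)
Lemma firstn_history_succ (T : Type) (g : nat -> T) l n i : i < n ->
  firstn (n - i) (history g l n) = firstn (n - S i) (history g l n) ++ [(g i, l i)].
Proof.
  induction n as [|n IH]; intros H; [lia|].
  replace (S n - i) with (S (n - i)) by lia. rewrite Nat.sub_succ. simpl history.
  destruct (Nat.eq_dec i n) as [->|N].
  - now rewrite Nat.sub_diag.
  - replace (n - i) with (S (n - S i)) at 2 by lia.
    rewrite !firstn_cons, IH by lia. reflexivity.
Qed.

(** All [k] are controlled at once so that replacing 1 by [x] as the newest unknown moves every
    earlier unknown by little. *)
Definition close_to_one (h : list (car * nat)) (x : car) : Prop :=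
  forall k, k <= length h -> (d (compose_history (firstn k h) gone)
    (compose_history (firstn k h) x) < (/ 2) ^ length h)%R.

Lemma nbhd_close_to_one h : nbhd gone (close_to_one h).
Proof.
  apply nbhd_forall_le. intros k _.
  apply (continuous_compose_history G (firstn k h) gone
    (fun z => (d (compose_history (firstn k h) gone) z < (/ 2) ^ length h)%R)).
  apply nbhd_ball. apply pow_lt. lra.
Qed.

(* [u i n] is the i-th unknown computed from the first [n] stages, with the n-th unknown
   replaced by 1. *)
Lemma metric_solution (g : nat -> car) (l : nat -> nat) :
  (forall n, close_to_one (history g l n) (g n)) ->
  exists y, forall n, y n = affine (g n) (l n) (y (S n)).
Proof.
  intros Hg.
  set (u := fun i n => compose_history (firstn (n - i) (history g l n)) (gone : car)).
  assert (Hlim : forall i, exists y, converges (u i) y).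
  { intros i. apply (geometric_converges _ i). intros n Hn.
    (* At 1 the newest affine map takes the value [g n] whatever [l n] is, so passing from [n] to
       [S n] just replaces 1 by [g n]. *)
    assert (E : u i (S n) = compose_history (firstn (n - i) (history g l n)) (g n)).
    { unfold u. replace (S n - i) with (S (n - i)) by lia. simpl. f_equal.
      apply affine_one. }
    rewrite E. specialize (Hg n (n - i)). rewrite length_history in Hg. apply Hg. lia. }
  apply choice in Hlim as [y Hy]. exists y. intros i.
  (* By continuity both sides of the equation are limits of [u i]. *)
  apply (converges_unique (u i)); auto.
  intros eps He.
  destruct (converges_continuous _ _ _ (continuous_affine G (g i) (l i)) (Hy (S i)) eps He)
    as [N HN].
  exists (N + S i). intros n Hn.
  assert (E : u i n = affine (g i) (l i) (u (S i) n)).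
  { unfold u. rewrite firstn_history_succ by lia. now rewrite compose_history_app. }
  rewrite E. apply HN. lia.
Qed.

End CompletelyMetrizable.

Theorem aleph1_free_cm_slender (K : Group) : aleph1_free K -> cm_slender K.
Proof.
  intros HK G f (d & Hd & Hc & Htop) Hf. apply NNPP; intros N.
  apply (selection K HK _ f (close_to_one G d)).
  - intros h. apply small_sixth_power; auto. now apply nbhd_close_to_one.
  - intros g l Hg. destruct (metric_solution G d Hd Hc Htop g l Hg) as [y Hy].
    exists (fun n => f (y n)). intros n. rewrite Hy at 1. unfold affine.
    now rewrite Hf, (hom_gpow G K f Hf).
Qed.

(** * Locally compact Hausdorff groups *)

Section LocallyCompact.
Variable G : TopGroup.
Local Notation car := (gcar (tgrp G)).
Hypothesis Hhaus : hausdorff G.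
Implicit Types C D : car -> Prop.

Definition closed C := topen G (fun x => ~ C x).

Lemma compact_closed C : compact_set G C -> closed C.
Proof.
  intros HC. apply topen_nbhd. intros x Nx.
  destruct (HC (fun U => topen G U /\ nbhd x (fun z => ~ U z))) as (s & Hs & Hcov).
  - now intros U [].
  - intros y Cy. destruct (Hhaus y x) as (U & V & OU & OV & Uy & Vx & HUV).
    { intros ->. auto. }
    exists U. repeat split; auto. exists V. repeat split; auto.
    intros z Vz Uz. now apply (HUV z).
  - assert (H : nbhd x (fun z => forall U, In U s -> ~ U z)).
    { clear Hcov. induction s as [|U s IH].
      - exists (fun _ => True). split; [apply topen_full|]. split; [exact I|]. now intros y _ V [].
      - apply (nbhd_mono _ _ (fun z => ~ U z /\ forall V, In V s -> ~ V z)).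
        + apply nbhd_and; [apply Hs; now left|]. apply IH. intros V HV. apply Hs. now right.
        + intros y [H1 H2] V [<-|HV]; auto. }
    apply (nbhd_mono _ _ _ _ H). intros z Hz Cz. destruct (Hcov z Cz) as (U & HU & Uz).
    now apply (Hz U).
Qed.

Lemma closed_subset_compact C D : compact_set G C -> closed D ->
  (forall x, D x -> C x) -> compact_set G D.
Proof.
  intros HC HD Sub F HF Hcov.
  destruct (HC (fun U => F U \/ U = (fun x => ~ D x))) as (s & Hs & Hcov').
  - intros U [| ->]; auto.
  - intros x Cx. destruct (classic (D x)) as [Dx|Nx].
    + destruct (Hcov x Dx) as (U & FU & Ux). exists U; auto.
    + exists (fun x => ~ D x). auto.
  (* Removes from the finite subcover the complement of [D], which covers no point of [D]. *)
  - assert (E : exists t, (forall U, In U t -> F U) /\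
      forall U x, In U s -> D x -> U x -> In U t).
    { clear Hcov'. induction s as [|U s IH].
      - exists []. split; [easy|]. intros U x [].
      - destruct IH as (t & Ht & Ht'); [intros V HV; apply Hs; now right|].
        destruct (Hs U) as [FU| ->]; [now left| |].
        + exists (U :: t). split; [intros V [<-|]; auto|].
          intros V x [<-|HV] Dx Vx; [now left|right; eauto].
        + exists t. split; auto. intros V x [<-|HV] Dx Vx; [easy|eauto]. }
    destruct E as (t & Ht & Ht'). exists t. split; auto.
    intros x Dx. destruct (Hcov' x (Sub x Dx)) as (U & HU & Ux). exists U; eauto.
Qed.

Lemma compact_image f C : continuous f -> compact_set G C ->
  compact_set G (fun y => exists x, C x /\ y = f x).
Proof.
  intros Hf HC F HF Hcov.
  destruct (HC (fun V => exists U, F U /\ V = (fun x => U (f x)))) as (s & Hs & Hcov').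
  - intros V (U & FU & ->). apply continuous_preimage; auto.
  - intros x Cx. destruct (Hcov (f x)) as (U & FU & Ux); [eauto|].
    exists (fun x => U (f x)). eauto.
  - assert (E : exists t, (forall U, In U t -> F U) /\
      forall V, In V s -> exists U, In U t /\ V = (fun x => U (f x))).
    { clear Hcov'. induction s as [|V s IH].
      - exists []. split; [easy|]. intros V [].
      - destruct IH as (t & Ht & Ht'); [intros W HW; apply Hs; now right|].
        destruct (Hs V) as (U & FU & EV); [now left|].
        exists (U :: t). split; [intros W [<-|]; auto|].
        intros W [<-|HW]; [exists U; split; auto; now left|].
        destruct (Ht' W HW) as (U' & HU' & E). exists U'. split; auto. now right. }
    destruct E as (t & Ht & Ht'). exists t. split; auto.
    intros y (x & Cx & ->). destruct (Hcov' x Cx) as (V & HV & Vx).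
    destruct (Ht' V HV) as (U & HU & ->). eauto.
Qed.

(** With empty intersection the complements would cover [C 0]; by monotonicity a finite subcover
    misses all of some [C m]. *)
Lemma nested_compact (C : nat -> car -> Prop) :
  compact_set G (C 0) -> (forall n, closed (C n)) ->
  (forall n x, C (S n) x -> C n x) -> (forall n, exists x, C n x) ->
  exists x, forall n, C n x.
Proof.
  intros H0 Hcl Hdec Hne. apply NNPP; intros N.
  assert (Hle : forall m n x, n <= m -> C m x -> C n x).
  { intros m n x L. induction L; auto. }
  destruct (H0 (fun U => exists n, U = (fun x => ~ C n x))) as (s & Hs & Hcov).
  - intros U (n & ->). apply Hcl.
  - intros x _. apply NNPP; intros N'. apply N. exists x. intros n.
    apply NNPP; intros N''. apply N'. exists (fun x => ~ C n x). eauto.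
  - assert (E : exists m, forall U x, In U s -> U x -> ~ C m x).
    { clear Hcov. induction s as [|U s IH].
      - exists 0. intros U x [].
      - destruct IH as [m Hm]; [intros V HV; apply Hs; now right|].
        destruct (Hs U) as [n ->]; [now left|].
        exists (m + n). intros V x [<-|HV] Vx HC.
        + apply Vx. apply (Hle (m + n)); auto. lia.
        + apply (Hm V x HV Vx). apply (Hle (m + n)); auto. lia. }
    destruct E as [m Hm]. destruct (Hne m) as [x Cx].
    destruct (Hcov x) as (U & HU & Ux); [apply (Hle m); auto; lia|].
    now apply (Hm U x).
Qed.

Lemma closed_preimage f C : continuous f -> closed C -> closed (fun x => C (f x)).
Proof. intros Hf HC. now apply (continuous_preimage G f (fun x => ~ C x)). Qed.

Lemma closed_and C D : closed C -> closed D -> closed (fun x => C x /\ D x).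
Proof.
  intros HC HD. apply topen_nbhd. intros x N. apply not_and_or in N as [N|N].
  - apply (nbhd_mono _ _ (fun x => ~ C x)); [now apply nbhd_open|tauto].
  - apply (nbhd_mono _ _ (fun x => ~ D x)); [now apply nbhd_open|tauto].
Qed.

Lemma closed_singleton y : closed (fun x => x = y).
Proof.
  apply topen_nbhd. intros x N. destruct (Hhaus x y N) as (U & V & OU & OV & Ux & Vy & H).
  exists U. repeat split; auto. intros z Uz ->. now apply (H y).
Qed.

Variable C0 : car -> Prop.
Hypothesis HC0 : compact_set G C0.
Hypothesis HC0' : nbhd gone C0.

(** Each new stage shrinks the set so that the affine map of that stage carries it into the previous
    set. *)
Fixpoint stage_set (h : list (car * nat)) (x : car) : Prop :=
  match h with
  | [] => C0 x
  | (g, n) :: h => stage_set h x /\ stage_set h (affine g n x)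
  end.

Lemma stage_set_compact h : compact_set G (stage_set h).
Proof.
  induction h as [|[g n] h IH]; simpl; auto.
  apply (closed_subset_compact (stage_set h)); auto; [|tauto].
  apply closed_and; [now apply compact_closed|].
  apply (closed_preimage (affine g n) (stage_set h)); [apply continuous_affine|].
  now apply compact_closed.
Qed.

(** The second alternative makes a choice possible after every history; the induction excludes it.
    The first suffices since [affine] sends 1 to [g n]. *)
Lemma stage_set_nbhd g l : (forall n, nbhd (g n) (stage_set (history g l n)) \/
    ~ nbhd gone (stage_set (history g l n))) ->
  forall n, nbhd gone (stage_set (history g l n)).
Proof.
  intros H n. induction n as [|n IH]; simpl; auto.
  apply nbhd_and; auto. apply continuous_affine. rewrite affine_one.
  destruct (H n); tauto.
Qed.

Lemma compact_solution (g : nat -> car) (l : nat -> nat) :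
  (forall n, nbhd gone (stage_set (history g l n))) ->
  exists y, forall n, y n = affine (g n) (l n) (y (S n)).
Proof.
  intros Hn. set (C := fun n => stage_set (history g l n)).
  set (T := fun n => affine (g n) (l n)).
  assert (CT : forall n, continuous (T n)) by (intros; apply continuous_affine).
  assert (CC : forall n, compact_set G (C n)) by (intros; apply stage_set_compact).
  (* [Z k n] holds the values of the unknown [n] that extend [k] equations further and end in
     [C (n + k)]. *)
  set (Z := fix Z k n := match k with
    | 0 => C n
    | S k => fun y => exists x, Z k (S n) x /\ y = T n x
    end).
  assert (Zc : forall k n, compact_set G (Z k n)).
  { induction k; intros n; simpl; auto. now apply compact_image. }
  assert (Zcl : forall k n, closed (Z k n)) by (intros; now apply compact_closed).
  (* At [k = 0] this is the inclusion of the image of [C (S n)] under [T n] in [C n], built into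
     [stage_set]. *)
  assert (Zdec : forall k n x, Z (S k) n x -> Z k n x).
  { induction k; intros n x (y & Hy & ->).
    - simpl in *. unfold C in Hy. simpl in Hy. apply Hy.
    - simpl. exists y. split; auto. }
  assert (Zne : forall k n, exists x, Z k n x).
  { induction k; intros n; simpl.
    - exists gone. apply (nbhd_self G), Hn.
    - destruct (IHk (S n)) as [x Hx]. eauto. }
  assert (Start : exists y, forall k, Z k 0 y).
  { apply (nested_compact (fun k => Z k 0)); auto. }
  (* The points of [Z k (S n)] over [y] form nested nonempty compact sets; a common point extends
     the solution by one unknown. *)
  assert (Next : forall n y, (forall k, Z k n y) ->
    exists x, (forall k, Z k (S n) x) /\ y = T n x).
  { intros n y Hy.
    destruct (nested_compact (fun k x => Z k (S n) x /\ T n x = y)) as [x Hx].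
    - apply (closed_subset_compact (Z 0 (S n))); auto; [|tauto].
      apply closed_and; auto.
      apply (closed_preimage (T n) (fun x => x = y)); auto. apply closed_singleton.
    - intros k. apply closed_and; auto.
      apply (closed_preimage (T n) (fun x => x = y)); auto. apply closed_singleton.
    - intros k x [H1 H2]. auto.
    - intros k. destruct (Hy (S k)) as (x & Hx & E). exists x. auto.
    - exists x. split; [apply Hx|]. symmetry. apply (Hx 0). }
  destruct Start as [y0 Hy0].
  (* Made total for the sake of choice: 1 is the default when [y] is not extendable. *)
  assert (Step : forall p : nat * car, exists x, (forall k, Z k (fst p) (snd p)) ->
    (forall k, Z k (S (fst p)) x) /\ snd p = T (fst p) x).
  { intros [n y]. simpl. destruct (classic (forall k, Z k n y)) as [H|H].
    - destruct (Next n y H) as [x Hx]. exists x. auto.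
    - exists gone. tauto. }
  apply choice in Step as [F HF].
  set (y := fix y n := match n with 0 => y0 | S n => F (n, y n) end).
  assert (Hy : forall n k, Z k n (y n)).
  { induction n; auto. now apply (HF (n, y n)). }
  exists y. intros n. apply (HF (n, y n)). simpl. auto.
Qed.

End LocallyCompact.

Theorem aleph1_free_lcH_slender (K : Group) : aleph1_free K -> lcH_slender K.
Proof.
  intros HK G f Hlc Hh Hf. apply NNPP; intros N.
  destruct (Hlc gone) as (U & C & OU & U1 & HUC & HC).
  assert (HC1 : nbhd gone C) by (exists U; auto).
  apply (selection K HK _ f (fun h x => nbhd x (stage_set G C h) \/
    ~ nbhd gone (stage_set G C h))).
  - intros h. destruct (classic (nbhd gone (stage_set G C h))) as [H|H].
    (* Passing to the open set [V] makes the stage set a neighbourhood of the chosen [x] as well. *)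
    + destruct H as (V & OV & V1 & HV).
      destruct (small_sixth_power G K f Hf V N) as (x & a & Vx & Ha).
      { now apply nbhd_open. }
      exists x, a. split; auto. left. exists V; auto.
    (* Here every element is admissible, but its image must still be a nontrivial sixth power. *)
    + destruct (small_sixth_power G K f Hf (fun _ => True) N) as (x & a & _ & Ha).
      { now apply (nbhd_mono _ _ C). }
      exists x, a. auto.
  - intros g l Hg. destruct (compact_solution G Hh C HC g l) as [y Hy].
    { apply stage_set_nbhd; auto. }
    exists (fun n => f (y n)). intros n. rewrite Hy at 1. unfold affine.
    now rewrite Hf, (hom_gpow G K f Hf).
Qed.

Theorem theoremA : forall H : Group,
  aleph1_free H -> n_slender H /\ cm_slender H /\ lcH_slender H.
Proof.
  intros H HH. split; [|split].
  - now apply aleph1_free_n_slender.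
  - now apply aleph1_free_cm_slender.
  - now apply aleph1_free_lcH_slender.
Qed.
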